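(* Let $1<p,q<\infty$ and suppose that $f:\mathbb{R}^d\times\mathbb{R}\times\mathbb{R}^d\to\mathbb{R}$ is an $\mathcal{L}^d\times\mathcal{B}$ measurable function such that $$f(x,z,\xi)\ge -C(|z|^q+|\xi|^p)-\omega(x)$$ for $\mathcal{L}^d$-almost every $x\in\mathbb{R}^d$ and for all $(z,\xi)\in\mathbb{R}\times\mathbb{R}^d$, for some $\omega\in L^1(\mathbb{R}^d)$ and $C>0$. Assume that $f(x,\cdot,\cdot)$ is lower semicontinuous in $\mathbb{R}\times\mathbb{R}^d$ for $\mathcal{L}^d$-almost every $x\in\mathbb{R}^d$. Further assume that: (i) $f(x,z,\cdot)$ is convex in $\mathbb{R}^d$ for $\mathcal{L}^d$-almost every $x\in\mathbb{R}^d$ and for all $z\in\mathbb{R}$; (ii) for $\mathcal{L}^d$-almost every $x\in\mathbb{R}^d$ and all $(z,\xi)\in\mathbb{R}\times\mathbb{R}^d$, $$f(x,z,\xi)\ge\alpha(x)-C|z|^q+\beta(x,z)\cdot\xi,$$ where $\alpha\in L^1(\mathbb{R}^d)$, $C>0$, and $\beta:\mathbb{R}^d\times\mathbb{R}\to\mathbb{R}^d$ is an $\mathcal{L}^d\times\mathcal{B}$ measurable function such that, for some $R>0$, $\beta(x,z)\equiv\tilde\beta(x)$ for $x$ outside $B(0,R)$, with $\tilde\beta\in L^{p/(p-1)}(B(0,R)^c;\mathbb{R}^d)$; (iii) for any sequences $\{u_n\}\subset L^q(\mathbb{R}^d)$ and $\{v_n\}\subset L^p(\mathbb{R}^d;\mathbb{R}^d)$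 such that $u_n\to u$ strongly in $L^q(\mathbb{R}^d)$ and $v_n\to v$ weakly in $L^p(\mathbb{R}^d;\mathbb{R}^d)$, and such that $$\sup_n\int_{B(0,R)}f(x,u_n(x),v_n(x))\,dx<+\infty,$$ the sequence $|\beta(x,u_n(x))|^{p/(p-1)}$ is equi-integrable in $B(0,R)$. Then the functional $$(u,v)\in L^q(\mathbb{R}^d)\times L^p(\mathbb{R}^d;\mathbb{R}^d)\mapsto\int_{\mathbb{R}^d}f(x,u,v)\,dx$$ is sequentially lower semicontinuous with respect to strong convergence in $L^q(\mathbb{R}^d)$ (of $u$) and weak convergence in $L^p(\mathbb{R}^d;\mathbb{R}^d)$ (of $v$).
   Context: $\mathcal{L}^d\times\mathcal{B}$ measurable means measurable with respect to the product of the $\sigma$-algebra of Lebesgue measurable sets in $\mathbb{R}^d$ (the variable $x$) and the Borel $\sigma$-algebra in the remaining variables. $B(0,R)$ is the ball centered at $0$ of radius $R$, and $B(0,R)^c$ its complement. The functional takes values in $(-\infty,+\infty]$. *)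

(* Defs.v *)
From HB Require Import structures.
From mathcomp Require Import all_boot all_order all_algebra.
From mathcomp Require Import all_classical all_reals all_analysis.

Set Implicit Arguments.
Unset Strict Implicit.
Unset Printing Implicit Defensive.

Import Order.TTheory GRing.Theory Num.Theory.
Import numFieldNormedType.Exports.

Local Open Scope classical_set_scope.
Local Open Scope ring_scope.

(* The Euclidean space of dimension n >= 1 is 'rV[R]_d.+1, where n = d.+1.
   The library norm on row vectors is the sup norm, hence [enorm]. *)
Section euclidean.
Context {R : realType} {d : nat}.
Implicit Types x y : 'rV[R]_d.+1.

Definition dotp x y : R := \sum_i x 0 i * y 0 i.

Definition enorm x : R := Num.sqrt (dotp x x).

Definition eball (r : R) : set 'rV[R]_d.+1 := [set x | enorm x < r].

End euclidean.

Notation borel T := (g_sigma_algebraType (@open T%type)).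

Section lebesgue_outer_measure.
Context (R : realType) (d : nat).
Local Notation V := 'rV[R]_d.+1.

Definition box (ab : V * V) : set V :=
  [set x | forall i, ab.1 0 i < x 0 i <= ab.2 0 i].

(* max with 0: a box with some b_i <= a_i is empty and has volume 0 *)
Definition box_vol (ab : V * V) : R :=
  \prod_i Num.max 0 (ab.2 0 i - ab.1 0 i).

Definition box_cover (A : set V) : set (nat -> V * V) :=
  [set B | A `<=` \bigcup_k box (B k)].

Local Open Scope ereal_scope.

Definition lebesgue_outer (A : set V) : \bar R :=
  ereal_inf [set \sum_(k <oo) (box_vol (B k))%:E | B in box_cover A].

Lemma box_vol_ge0 ab : (0 <= box_vol ab)%R.
Proof. by apply: prodr_ge0 => i _; rewrite le_max lexx. Qed.

Lemma lebesgue_outer_ge0 A : 0 <= lebesgue_outer A.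
Proof.
apply: le_ereal_inf_tmp => _ [B _ <-].
by apply: nneseries_ge0 => n _ _; rewrite lee_fin box_vol_ge0.
Qed.

Lemma lebesgue_outer0 : lebesgue_outer set0 = 0.
Proof.
apply/eqP; rewrite eq_le lebesgue_outer_ge0 andbT.
apply: ereal_inf_lbound; exists (fun=> (0%R, 0%R)); first by move=> x.
apply: eseries0 => k _ _.
by rewrite /box_vol big_ord_recl mxE subrr maxxx mul0r.
Qed.

Lemma le_lebesgue_outer : {homo lebesgue_outer : A B / A `<=` B >-> A <= B}.
Proof.
move=> A B AB; apply: ereal_inf_le_tmp => _ [F FB <-].
by exists F => //; exact: subset_trans AB FB.
Qed.

Lemma lebesgue_outer_sigma_subadditive : sigma_subadditive lebesgue_outer.
Proof.
move=> A; have [[i ioo]|] := pselect (exists i, lebesgue_outer (A i) = +oo).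
  rewrite (eseries_pinfty _ _ ioo) ?leey// => n _.
  by rewrite -ltNye (lt_le_trans _ (lebesgue_outer_ge0 _)).
rewrite -forallNE => Aoo.
suff add2e (e : {posnum R}) : lebesgue_outer (\bigcup_n A n) <=
    \sum_(i <oo) lebesgue_outer (A i) + e%:num%:E.
  by apply/lee_addgt0Pr => _/posnumP[].
rewrite (le_trans _ (epsilon_trick _ _ _))//; last first.
  by move=> n; exact: lebesgue_outer_ge0.
pose P n (B : nat -> V * V) := box_cover (A n) B /\
  \sum_(k <oo) (box_vol (B k))%:E <=
    lebesgue_outer (A n) + (e%:num / (2 ^ n.+1)%:R)%:E.
have [G PG] : {G : nat -> nat -> V * V & forall n, P n (G n)}.
  apply: (@choice _ _ P) => n; rewrite /P /lebesgue_outer.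
  set S := (X in ereal_inf X); move infS : (ereal_inf S) => iS.
  case: iS infS => [r Sr|Soo|Soo].
  - have en1 : (0 < e%:num / (2 ^ n.+1)%:R)%R by [].
    have /(lb_ereal_inf_adherent en1) : ereal_inf S \is a fin_num by rewrite Sr.
    move=> [x [B AnB muBx] xS].
    by exists B; split => //; rewrite muBx -Sr; exact/ltW.
  - by have := Aoo n; rewrite /lebesgue_outer Soo.
  - by have := lebesgue_outer_ge0 (A n); rewrite /lebesgue_outer Soo.
pose g (ij : nat * nat) := (box_vol (G ij.1 ij.2))%:E.
have g_ge0 x : 0 <= g x by rewrite lee_fin box_vol_ge0.
apply: (@le_trans _ _ (\esum_(i in setT) g i)).
  apply: ereal_inf_lbound => /=.
  have /card_esym/ppcard_eqP[f] := card_nat2.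
  exists (fun k => G (f k).1 (f k).2).
    move=> t [i _] /(PG i).1 [j _ Gij]; exists (f^-1%FUN (i, j)) => //=.
    by rewrite invK ?inE.
  transitivity (\sum_(k <oo) g (f k)) => //.
  rewrite -(esum_pred_image g _ xpredT) ?[fun=> _]set_true//.
  by rewrite image_eq.
rewrite (_ : esum _ _ = \sum_(i <oo) \sum_(j <oo) g (i, j)); last first.
  pose J : nat -> set (nat * nat) := fun i => [set (i, j) | j in setT].
  rewrite (_ : setT = \bigcup_k J k); last first.
    by rewrite predeqE => -[a b]; split => // _; exists a => //; exists b.
  rewrite esum_bigcupT /=; last 2 first.
    - apply/trivIsetP => i j _ _ ij.
      rewrite predeqE => -[n m] /=; split => //= -[] [_] _ [<-{n} _].
      by move=> [m' _] [] /esym/eqP; rewrite (negbTE ij).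
    - by move=> /= x; exact: g_ge0.
  rewrite -(image_id [set: nat]) -fun_true esum_pred_image//; last first.
    by move=> n _; exact: esum_ge0.
  apply: eq_eseriesr => /= j _.
  rewrite -(esum_pred_image g (pair j) predT)//=; last first.
    by move=> ? ? _ _; exact: (@can_inj _ _ _ snd).
  by congr esum; rewrite predeqE => -[a b]; split; move=> [i _ <-]; exists i.
apply: lee_lim.
- apply: is_cvg_nneseries => n *.
  by apply: nneseries_ge0 => m *; exact: g_ge0.
- by apply: is_cvg_nneseries => n *; apply: adde_ge0 => //;
    exact: lebesgue_outer_ge0.
- by near=> n; apply: lee_sum => i _; exact: (PG i).2.
Unshelve. all: by end_near. Qed.

HB.instance Definition _ := isOuterMeasure.Build R V lebesgue_outer
  lebesgue_outer0 lebesgue_outer_ge0 le_lebesgue_outer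
  lebesgue_outer_sigma_subadditive.

End lebesgue_outer_measure.

(* R^n (n = d.+1) with its Lebesgue measurable sets, obtained as the
   Caratheodory measurable sets of the outer measure *)
Notation lebRn R d := (caratheodory_type (@lebesgue_outer R d)).

Section lebesgue_measure_Rn.
Context (R : realType) (d : nat).

Definition lebesgue_Rn : set (lebRn R d) -> \bar R := @lebesgue_outer R d.

Let lebesgue_Rn0 : lebesgue_Rn set0 = 0%E.
Proof. exact: lebesgue_outer0. Qed.

Let lebesgue_Rn_ge0 A : (0 <= lebesgue_Rn A)%E.
Proof. exact: lebesgue_outer_ge0. Qed.

Let lebesgue_Rn_sigma_additive : semi_sigma_additive lebesgue_Rn.
Proof. exact: caratheodory_measure_sigma_additive. Qed.

HB.instance Definition _ := isMeasure.Build _ (lebRn R d) R lebesgue_Rn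
  lebesgue_Rn0 lebesgue_Rn_ge0 lebesgue_Rn_sigma_additive.

End lebesgue_measure_Rn.
Arguments lebesgue_Rn : clear implicits.

Section Lp_spaces.
Context {R : realType} {d : nat}.
Local Notation V := 'rV[R]_d.+1.
Local Notation X := (lebRn R d).
Local Notation mu := (lebesgue_Rn R d).
Implicit Types (D : set X) (p q : R) (v w : X -> borel V).

Definition Lpnorm_vec D p v : \bar R :=
  ((\int[mu]_(x in D) (enorm (v x) `^ p)%:E) `^ p^-1)%E.

Definition Lp_vec D p v : Prop :=
  measurable_fun D v /\ (Lpnorm_vec D p v < +oo)%E.

(* L is a continuous linear functional on L^p(R^n; R^n). Elements of L^p are
   represented by functions; boundedness forces L to be invariant under almost
   everywhere equality. *)
Definition Lp_vec_dual p (L : (X -> borel V) -> R) : Prop :=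
  (forall (a : R) v w, Lp_vec setT p v -> Lp_vec setT p w ->
     L (fun x => a *: (v x : V) + (w x : V)) = a * L v + L w) /\
  exists K : R, forall v, Lp_vec setT p v ->
    (`|L v|%:E <= K%:E * Lpnorm_vec setT p v)%E.

Definition Lp_weak_cvg p (vn : nat -> X -> borel V) v : Prop :=
  [/\ forall n, Lp_vec setT p (vn n),
      Lp_vec setT p v &
      forall L, Lp_vec_dual p L -> L (vn n) @[n --> \oo] --> L v].

Definition Lq_strong_cvg q (un : nat -> X -> R) (u : X -> R) : Prop :=
  [/\ forall n, un n \in Lfun mu q%:E,
      u \in Lfun mu q%:E &
      ('N[mu]_(q%:E)[EFin \o (un n \- u)%R])%E @[n --> \oo] --> 0%E].

(* D is meant to have finite measure, so that no tightness condition is needed *)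
Definition equi_integrable D (g : nat -> X -> R) : Prop :=
  forall e : R, 0 < e -> exists2 delta : R, 0 < delta &
    forall E : set X, measurable E -> E `<=` D -> (mu E <= delta%:E)%E ->
    forall n, (\int[mu]_(x in E) `|g n x|%:E <= e%:E)%E.

Definition strong_weak_seq_lsc q p
    (F : (X -> R) -> (X -> borel V) -> \bar R) : Prop :=
  forall un u vn v, Lq_strong_cvg q un u -> Lp_weak_cvg p vn v ->
    (F u v <= limn_einf (fun n => F (un n) (vn n)))%E.

End Lp_spaces.

(* Main.v *)
Require Import Defs.
From mathcomp Require Import all_boot all_order all_algebra.
From mathcomp Require Import all_classical all_reals all_analysis.
From mathcomp Require Import measurable_realfun.
From mathcomp Require Import ring lra.

Set Implicit Arguments.
Unset Strict Implicit.
Unset Printing Implicit Defensive.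

Import Order.TTheory GRing.Theory Num.Theory.
Import numFieldNormedType.Exports.

Local Open Scope classical_set_scope.
Local Open Scope ring_scope.

(** Suppose that the limit inferior is less than some [c] less than the value at
   the limit, and pass to a subsequence along which the functional stays below [c],
   [un] converges to [u] almost everywhere and [vn] is bounded in [L^p]. The
   difficulty is that [f x z xi] is convex in [xi] but may grow linearly, or not at
   all, so that large values of [vn] cannot be neglected; what saves the day is the
   lower bound [f x (un x) (vn x) >= - G n x], where

     G n = |alpha| + C2 |un|^q + |beta(x, un)| |vn|.

   The integrals of [G n] are small, uniformly in [n], on sets that are small inside
   some set [D] of finite measure and arbitrary outside of it
   ([lower_bound_unif]). For the last term this is Young's inequality applied to the
   equi-integrable [|beta(x, un)|^p'] and to [vn], which is bounded in [L^p]
   ([unif_integrableM]); outside the ball, [beta] does not depend on [un].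

   Boundedness of [vn] is the uniform boundedness principle
   ([pointwise_bounded_norm_bounded]), proved for [L^p] by a gliding hump argument
   with the functionals that Hoelder's inequality makes norming.

   For the main inequality ([truncated_lsc]), fix a small [e]. For almost every [x]
   the convex function [f x (u x) _] has an affine minorant almost touching it at
   [v x]; with rational coefficients it is a minorant up to [e (1 + |xi|)]
   ([convex_rational_minorant]). Choosing among countably many candidates gives
   bounded measurable [a] and [b] on a set [S] which fills [D] up to a small measure
   ([affine_selection]). By joint lower semicontinuity and compactness of balls,
   [a x + b x . xi] bounds [f x (un x) xi] from below too, up to [e (2 + |xi|)], for
   all [|xi| <= M] as soon as [n] is large depending on [x]
   ([lsc_minorant_near]). Hence

     f x (un x) (vn x) >= a x + b x . vn x - e (2 + |vn x|)

   on [S], except on a set of small measure where either [|vn x| > M] or [n] is not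
   yet large; there, and outside [S], the bound [- G n] is used, at a small cost. The
   right-hand side is affine in [vn], so that weak convergence, tested only against
   the bounded field [b] carried by [S], yields
   [\int_S (a + b . v) <= c] up to small errors. The left-hand side is nearly
   [\int_S f x (u x) (v x)]; letting the errors vanish, with the integrable lower
   bound on [f x (u x) (v x)] and monotone convergence, gives
   [\int f x (u x) (v x) <= c], a contradiction ([integral_lsc_le],
   [functional_lsc]).

   All this takes place over an arbitrary sigma-finite measure space. Lebesgue measure
   only has to be shown to be one in which Borel sets are measurable and balls have
   finite measure, which reduces to cutting boxes by hyperplanes. *)

(** * The Euclidean norm *)

Section euclidean_space.
Context {R : realType} {d : nat}.
Local Notation V := 'rV[R]_d.+1.
Implicit Types x y z : V.

Lemma dotpC x y : dotp x y = dotp y x.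
Proof. by apply: eq_bigr => i _; rewrite mulrC. Qed.

Lemma dotpDr x y z : dotp x (y + z) = dotp x y + dotp x z.
Proof. by rewrite /dotp -big_split; apply: eq_bigr => i _; rewrite mxE mulrDr. Qed.

Lemma dotpZr (a : R) x y : dotp x (a *: y) = a * dotp x y.
Proof. by rewrite /dotp mulr_sumr; apply: eq_bigr => i _; rewrite mxE mulrCA. Qed.

Lemma dotpBr x y z : dotp x (y - z) = dotp x y - dotp x z.
Proof. by rewrite dotpDr -scaleN1r dotpZr mulN1r. Qed.

Lemma dotpDl x y z : dotp (x + y) z = dotp x z + dotp y z.
Proof. by rewrite dotpC dotpDr !(dotpC z). Qed.

Lemma dotpBl x y z : dotp (x - y) z = dotp x z - dotp y z.
Proof. by rewrite dotpC dotpBr !(dotpC z). Qed.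

Lemma dotpZl (a : R) x y : dotp (a *: x) y = a * dotp x y.
Proof. by rewrite dotpC dotpZr dotpC. Qed.

Lemma dotp0l x : dotp 0 x = 0.
Proof. by rewrite -(scale0r 0) dotpZl mul0r. Qed.

Lemma dotpxx_ge0 x : 0 <= dotp x x.
Proof. by apply: sumr_ge0 => i _; rewrite -expr2 sqr_ge0. Qed.

Lemma enorm_ge0 x : 0 <= enorm x.
Proof. exact: sqrtr_ge0. Qed.

Lemma sqr_enorm x : enorm x ^+ 2 = dotp x x.
Proof. exact/sqr_sqrtr/dotpxx_ge0. Qed.

Lemma enormZ (a : R) x : enorm (a *: x) = `|a| * enorm x.
Proof.
by rewrite /enorm dotpZl dotpZr mulrA -expr2 sqrtrM ?sqr_ge0// sqrtr_sqr.
Qed.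

Lemma coord_le_enorm x i : `|x 0 i| <= enorm x.
Proof.
rewrite -(ler_pXn2r (ltn0Sn 1)) ?nnegrE ?enorm_ge0// sqr_enorm real_normK ?num_real//.
by rewrite /dotp (bigD1 i)//= -expr2 lerDl; apply: sumr_ge0 => j _;
  rewrite -expr2 sqr_ge0.
Qed.

Lemma enorm_eq0 x : enorm x = 0 -> x = 0.
Proof.
move=> x0; apply/rowP => i; rewrite mxE; apply/eqP.
by rewrite -normr_eq0 eq_le normr_ge0 andbT -x0 coord_le_enorm.
Qed.

Lemma coord_le_norm x i : `|x 0 i| <= `|x|.
Proof.
rewrite [leRHS]/Num.norm/= mx_normrE.
exact: (le_bigmax _ (fun ij : 'I_1 * 'I_d.+1 => `|x ij.1 ij.2|) (0, i)).
Qed.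

Lemma norm_le_enorm x : `|x| <= enorm x.
Proof.
rewrite [leLHS]/Num.norm/= mx_normrE; apply: bigmax_le; first exact: enorm_ge0.
by move=> [i j] _ /=; rewrite [i]ord1 coord_le_enorm.
Qed.

(** The vector [dotp y y *: x - dotp x y *: y] is a multiple of the component of
   [x] orthogonal to [y]; expand its square. *)
Lemma cauchy_schwarz x y : `|dotp x y| <= enorm x * enorm y.
Proof.
have [y0|ypos] := eqVneq (dotp y y) 0.
  have -> : y = 0 by apply: enorm_eq0; rewrite /enorm y0 sqrtr0.
  by rewrite dotpC dotp0l normr0 mulr_ge0 ?enorm_ge0.
have {}ypos : 0 < dotp y y by rewrite lt_def ypos dotpxx_ge0.
rewrite -(ler_pXn2r (ltn0Sn 1)) ?nnegrE ?mulr_ge0 ?enorm_ge0//.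
rewrite exprMn !sqr_enorm real_normK ?num_real//.
have := dotpxx_ge0 (dotp y y *: x - dotp x y *: y).
rewrite !(dotpBl, dotpBr, dotpZl, dotpZr) (dotpC y x) => h.
by rewrite -(ler_pM2l ypos); lra.
Qed.

Lemma dotp_ge x y : - (enorm x * enorm y) <= dotp x y.
Proof. by have := cauchy_schwarz x y; rewrite ler_norml => /andP[]. Qed.

Lemma enorm_le_sum x : enorm x <= \sum_i `|x 0 i|.
Proof.
have s0 : 0 <= \sum_i `|x 0 i| by exact: sumr_ge0.
rewrite -(ler_pXn2r (ltn0Sn 1)) ?nnegrE ?enorm_ge0// sqr_enorm expr2 mulr_suml.
apply: ler_sum => i _; rewrite -expr2 -real_normK ?num_real// expr2.
by apply: ler_wpM2l => //; rewrite (bigD1 i)//= lerDl; exact: sumr_ge0.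
Qed.

Lemma continuous_coord i : continuous (fun x : V => x 0 i).
Proof. exact: coord_continuous. Qed.

Let continuous_sumr (F : 'I_d.+1 -> V -> R) :
  (forall i, continuous (F i)) -> continuous (fun x => \sum_i F i x).
Proof.
by move=> cF; apply: (@continuous_big R _ +%R 0 xpredT (@add_continuous R)).
Qed.

Lemma continuous_dotpr (b : V) : continuous (fun x : V => dotp b x).
Proof.
apply: (continuous_sumr (F := fun i x => b 0 i * x 0 i)) => i x.
by apply: continuousM; [exact: cst_continuous|exact: continuous_coord].
Qed.

Lemma continuous_dotpxx (c : V) : continuous (fun x : V => dotp (x - c) (x - c)).
Proof.
apply: (continuous_sumr (F := fun i x => (x - c) 0 i * (x - c) 0 i)) => i x.
have h : continuous (fun y : V => (y - c) 0 i).
  rewrite (_ : (fun _ => _) = (fun y : V => y 0 i) \- cst (c 0 i)); last first.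
    by apply/funext => y; rewrite !mxE.
  by move=> y; apply: continuousB; [exact: continuous_coord|exact: cst_continuous].
by apply: continuousM; exact: h.
Qed.

Lemma continuous_enorm : continuous (@enorm R d).
Proof.
move=> x; apply: (@continuous_comp _ _ _ (fun x : V => dotp x x) Num.sqrt).
  have := @continuous_dotpxx 0 x.
  by rewrite /continuous_at subr0; under eq_fun do rewrite subr0.
exact: sqrt_continuous.
Qed.

End euclidean_space.

(** * Convex functions and their affine minorants *)

Section convex_functions.
Context {R : realType} {d : nat}.
Local Notation V := 'rV[R]_d.+1.
Variable g : V -> R.
Hypothesis g_convex : forall (t : R) x y, 0 <= t <= 1 ->
  g (t *: x + (1 - t) *: y) <= t * g x + (1 - t) * g y.

Let usc_line (x e : V) c : g x < c ->
  exists2 del, 0 < del & forall t, `|t| < del -> g (x + t *: e) < c.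
Proof.
move=> gxc; pose A := `|g (x + e) - g x| + `|g (x - e) - g x| + 1.
have A0 : 0 < A by rewrite /A; have := normr_ge0 (g (x + e) - g x);
  have := normr_ge0 (g (x - e) - g x); lra.
have step s e' : 0 <= s -> s <= 1 -> `|g (x + e') - g x| <= A ->
    g (x + s *: e') <= g x + s * A.
  move=> s0 s1 hA; have := @g_convex s (x + e') x _; rewrite s0 s1 => /(_ isT).
  rewrite (_ : s *: (x + e') + (1 - s) *: x = x + s *: e'); last first.
    by rewrite scalerDr scalerBl scale1r (addrC (s *: x)) (addrC x (- _))
      addrA addrK addrC.
  move=> /le_trans; apply; have := ler_norm (g (x + e') - g x) => hn.
  have : s * (g (x + e') - g x) <= s * A by rewrite ler_wpM2l// (le_trans hn).
  lra.
exists (Num.min 1 ((c - g x) / A)).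
  by rewrite lt_min ltr01/= divr_gt0// subr_gt0.
move=> t; rewrite lt_min => /andP[t1 tA].
have {}tA : `|t| * A < c - g x by rewrite -ltr_pdivlMr.
have [t0|t0] := leP 0 t.
  rewrite ger0_norm// in t1 tA.
  have := @step t e t0 (ltW t1).
  rewrite /A => /(_ _)/le_lt_trans; apply; last by rewrite /A in tA; lra.
  by have := normr_ge0 (g (x - e) - g x); lra.
rewrite ltr0_norm// in t1 tA.
have := @step (- t) (- e) _ (ltW t1); rewrite oppr_ge0 ltW// => /(_ isT).
rewrite scaleNr scalerN opprK => /(_ _)/le_lt_trans; apply.
  by rewrite /A; have := normr_ge0 (g (x + e) - g x); lra.
lra.
Qed.

(** A finite convex function is upper semicontinuous along each coordinate
   direction; convexity at midpoints propagates this to sums of directions. *)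
Lemma convex_usc (x : V) c : g x < c -> \forall y \near x, g y < c.
Proof.
move=> gxc.
have usc_sum (s : seq 'I_d.+1) : forall c', g x < c' -> exists2 del, 0 < del &
    forall t : 'I_d.+1 -> R, (forall i, `|t i| < del) ->
    g (x + \sum_(i <- s) t i *: delta_mx 0 i) < c'.
  elim: s => [|i s ih] c' gxc'.
    by exists 1 => // t _; rewrite big_nil addr0.
  (* [x + t i e_i + w] is the midpoint of [x + 2 t i e_i] and [x + 2 w]. *)
  have [d1 d10 h1] := usc_line (delta_mx 0 i) gxc'.
  have [d2 d20 h2] := ih _ gxc'.
  exists (Num.min d1 d2 / 2); first by rewrite divr_gt0// lt_min d10.
  move=> t ht; rewrite big_cons.
  have ht' j : `|2 * t j| < Num.min d1 d2.
    by rewrite normrM ger0_norm// mulrC -ltr_pdivlMr.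
  have := @g_convex 2^-1 (x + (2 * t i) *: delta_mx 0 i)
    (x + \sum_(j <- s) (2 * t j) *: delta_mx 0 j) _.
  have -> : 2^-1 *: (x + (2 * t i) *: delta_mx 0 i) +
      (1 - 2^-1) *: (x + \sum_(j <- s) (2 * t j) *: delta_mx 0 j) =
      x + (t i *: delta_mx 0 i + \sum_(j <- s) t j *: delta_mx 0 j).
    rewrite (_ : 1 - 2^-1 = 2^-1 :> R); last by field.
    rewrite !scalerDr addrACA -scalerDl scalerA mulKf//.
    rewrite (_ : 2^-1 + 2^-1 = 1 :> R) ?scale1r; last by field.
    congr (_ + (_ + _)); rewrite scaler_sumr; apply: eq_bigr => j _.
    by rewrite scalerA mulKf.
  move=> /(_ _)/le_lt_trans; apply; first by lra.
  have : g (x + (2 * t i) *: delta_mx 0 i) < c'.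
    by apply: h1; apply: lt_le_trans (ht' i) _; rewrite ge_min lexx.
  have : g (x + \sum_(j <- s) (2 * t j) *: delta_mx 0 j) < c'.
    by apply: h2 => j; apply: lt_le_trans (ht' j) _; rewrite ge_min lexx orbT.
  lra.
have [del del0 h] := usc_sum (index_enum 'I_d.+1) c gxc.
near=> y.
rewrite -(subrK x y) (addrC _ x) [y - x]row_sum_delta; apply: h => i.
apply: le_lt_trans (coord_le_norm (y - x) i) _.
by rewrite distrC; near: y; have := nbhsx_ballx x _ del0; rewrite -ball_normE.
Unshelve. all: by end_near. Qed.

Hypothesis g_lsc : forall x c, c < g x -> \forall y \near x, c < g y.

Let g_continuous : continuous g.
Proof.
move=> x; apply/(@cvgrPdist_lt _ _ _ _ (nbhs_filter x)) => e e0; near=> y.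
rewrite distrC ltr_distl; apply/andP; split; near: y.
  by apply: g_lsc; rewrite ltrBlDr ltrDl.
by apply: convex_usc; rewrite ltrDl.
Unshelve. all: by end_near. Qed.

(** Minimising [g + k |. - x0|^2] over a small ball, with [k] large enough
   to keep the minimiser [xs] interior, gives the supporting affine function
   of slope [-2 k (xs - x0)] at [xs]. *)
Lemma convex_affine_minorant (x0 : V) e : 0 < e ->
  exists a (b : V), (forall x, a + dotp b x <= g x) /\ g x0 - e <= a + dotp b x0.
Proof.
move=> e0.
have /nbhs_ballP[r /= r0 hr] : \forall y \near x0, g x0 - e < g y.
  by apply: g_lsc; rewrite ltrBlDr ltrDl.
pose r' := r / 2; have r'0 : 0 < r' by rewrite divr_gt0.
(* On the ball, [k |xs - x0|^2 <= g x0 - g xs < e], so this [k] gives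
   [|xs - x0| < r']. *)
pose k := e / r' ^+ 2; have k0 : 0 < k by rewrite divr_gt0 ?exprn_gt0.
pose K : set V := closed_ball x0 r'.
have K_le y : K y = (`|x0 - y| <= r') by rewrite /K closed_ballE.
have gK y : K y -> g x0 - e < g y.
  rewrite K_le => xy; apply: hr; rewrite -ball_normE /=.
  by apply: le_lt_trans xy _; rewrite /r'; lra.
have cK : compact K.
  apply: bounded_closed_compact; last exact: closed_ball_closed.
  exists (`|x0| + r'); split => [|M hM y]; first exact: num_real.
  rewrite K_le => xy; apply: le_trans (ltW hM).
  rewrite -[y](subKr x0); apply: le_trans (ler_normB _ _) _.
  by rewrite lerD2l.
pose phi y := g y + k * dotp (y - x0) (y - x0).
have cphi : continuous phi.
  move=> y; apply: (@continuousD _ _ _ g (fun y => k * dotp (y - x0) (y - x0)));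
    first exact: g_continuous.
  by apply: continuousM; [exact: cst_continuous|exact: continuous_dotpxx].
have Kx0 : K x0 by rewrite K_le subrr normr0 ltW.
have [||xs] := @compact_EVT_min V R phi K _ cK.
  by exists x0.
  exact: continuous_subspaceT.
rewrite inE => Kxs min_xs; have {}min_xs y : K y -> phi xs <= phi y.
  by move=> Ky; apply: min_xs; rewrite inE.
have [h hE] : {h | h = xs - x0} by exists (xs - x0).
have hr' : `|h| < r'.
  have := min_xs _ Kx0; rewrite /phi subrr dotp0l mulr0 addr0 -hE => hle.
  have : k * dotp h h < e by have := gK _ Kxs; lra.
  rewrite -ltr_pdivlMl// /k invf_div mulrVK ?unitfE ?gt_eqF//.
  rewrite -sqr_enorm ltr_pXn2r ?nnegrE ?enorm_ge0 ?(ltW r'0)//.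
  by apply: le_lt_trans; exact: norm_le_enorm.
have support x : 0 <= g x - g xs + 2 * k * dotp h (x - xs).
  rewrite leNgt; apply/negP => neg.
  have [y yE] : {y | y = x - xs} by exists (x - xs).
  pose D := k * dotp y y.
  have D0 : 0 <= D by rewrite mulr_ge0 ?dotpxx_ge0 ?ltW.
  (* Moving from [xs] by a fraction [t] towards [x] stays in the ball, and changes
     the minimised function by [t * (_ + t * D)] at most, [_] being the negative
     quantity under scrutiny. *)
  pose t := Num.min (Num.min 1 ((r' - `|h|) / (`|y| + 1)))
    (- (g x - g xs + 2 * k * dotp h y) / (2 * (D + 1))).
  have t0 : 0 < t.
    rewrite !lt_min ltr01 !divr_gt0 ?mulr_gt0 ?subr_gt0 ?ltr_wpDl ?normr_ge0//.
    by rewrite oppr_gt0 yE.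
  have t1 : t <= 1 by rewrite /t !ge_min lexx.
  have Kt : K (xs + t *: y).
    rewrite K_le distrC addrAC -hE; apply: le_trans (ler_normD _ _) _.
    rewrite -lerBrDl normrZ gtr0_norm//.
    have : t <= (r' - `|h|) / (`|y| + 1) by rewrite /t !ge_min lexx orbT.
    rewrite ler_pdivlMr ?ltr_wpDl//; apply: le_trans.
    by rewrite ler_wpM2l ?lerDl// ltW.
  have := min_xs _ Kt; rewrite /phi addrAC -hE.
  have := @g_convex t x xs; rewrite (ltW t0) t1 => /(_ isT).
  rewrite (_ : t *: x + (1 - t) *: xs = xs + t *: y); last first.
    by rewrite yE scalerBr scalerBl scale1r addrCA addrA.
  rewrite !(dotpDl, dotpDr, dotpZl, dotpZr) (dotpC y h) => h1 h2.
  have : 0 <= t * (g x - g xs + 2 * k * dotp h y + t * D).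
    by rewrite /D; lra.
  rewrite pmulr_rge0//.
  have : t <= - (g x - g xs + 2 * k * dotp h y) / (2 * (D + 1)).
    by rewrite /t ge_min lexx orbT.
  rewrite ler_pdivlMr ?mulr_gt0 ?ltr_wpDl// => h3.
  by rewrite -yE in neg; have := mulr_ge0 (ltW t0) D0; lra.
exists (g xs + 2 * k * dotp h xs), (- (2 * k) *: h); split => [x|].
  by have := support x; rewrite dotpBr dotpZl; lra.
have : dotp h h = dotp h xs - dotp h x0 by rewrite {2}hE dotpBr.
rewrite dotpZl => hh.
have := gK _ Kxs; have := mulr_ge0 (ltW k0) (dotpxx_ge0 h); rewrite hh; lra.
Qed.

(** The slope is only approximated, which costs a term linear in [enorm x]: a
   function such as a linear one of irrational slope has no rational affine
   minorant. *)
Lemma convex_rational_minorant (x0 : V) e : 0 < e ->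
  exists (a : rat) (b : 'rV[rat]_d.+1),
    (forall x, ratr a + dotp (map_mx ratr b) x - e * (1 + enorm x) <= g x) /\
    g x0 - e * (2 + enorm x0) <= ratr a + dotp (map_mx ratr b) x0.
Proof.
move=> e0; have [a [b [ab abx0]]] := convex_affine_minorant x0 e0.
pose n : R := d.+1%:R; have n0 : 0 < n by rewrite ltr0n.
have near_rat (y r : R) : 0 < r -> exists q : rat, `|ratr q - y| <= r.
  move=> r0; have [|q] := @rat_in_itvoo R (y - r) (y + r); first by rewrite ltrD2l gtrN.
  by rewrite in_itv/= => hq; exists q; rewrite ltW// ltr_distl.
have [a' ha'] := near_rat a _ e0.
have /choice[q hq] i := near_rat (b 0 i) (e / n) (divr_gt0 e0 n0).
exists a', (\row_i q i).
set b' := map_mx _ _.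
have bb' : enorm (b' - b) <= e.
  apply: le_trans (enorm_le_sum _) _.
  rewrite (_ : e = \sum_(i < d.+1) (e / n)); last first.
    by rewrite sumr_const card_ord -mulr_natr divfK// gt_eqF.
  by apply: ler_sum => i _; rewrite !mxE.
have diff x : `|dotp b' x - dotp b x| <= e * enorm x.
  rewrite -dotpBl; apply: le_trans (cauchy_schwarz _ _) _.
  by rewrite ler_wpM2r// enorm_ge0.
move: ha'; rewrite ler_distl => /andP[a1 a2].
split=> [x|]; [have := ab x; have := diff x|have := diff x0];
  rewrite ler_distl => /andP[]; lra.
Qed.

End convex_functions.

(** Lower semicontinuity in both variables keeps the inequality near each
   point of the compact ball, hence uniformly on it. *)
Lemma lsc_minorant_near (R : realType) (d : nat) (f : R -> 'rV[R]_d.+1 -> R)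
    (z0 a e M : R) (b : 'rV[R]_d.+1) :
    lower_semicontinuous (fun w : R * 'rV[R]_d.+1 => (f w.1 w.2)%:E) -> 0 < e ->
    (forall x, a + dotp b x - e * (1 + enorm x) <= f z0 x) ->
  \forall z \near z0, forall x, enorm x <= M ->
    a + dotp b x - e * (2 + enorm x) <= f z x.
Proof.
move=> f_lsc e0 hz0; pose phi x := a + dotp b x - e * (2 + enorm x).
pose K : set 'rV[R]_d.+1 := [set x | enorm x <= M].
have cphi : continuous phi.
  move=> x; apply: (@continuousB _ _ _ (fun x => a + dotp b x)
      (fun x => e * (2 + enorm x))).
    apply: continuousD; [exact: cst_continuous|exact: continuous_dotpr].
  apply: continuousM; first exact: cst_continuous.
  by apply: continuousD; [exact: cst_continuous|exact: continuous_enorm].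
have cK : compact K.
  apply: bounded_closed_compact.
    exists M; split => [|N MN x /= xM]; first exact: num_real.
    by rewrite (le_trans (norm_le_enorm x))// (le_trans xM)// ltW.
  apply: (@closed_comp _ _ (@enorm R d) [set y | y <= M]); last exact: closed_le.
    by move=> x _; exact: continuous_enorm.
have := (compact_near_coveringP K).1 cK R (nbhs z0) (fun z x => phi x <= f z x) _.
apply => x _.
have [|W W0 hW] := f_lsc (z0, x) (phi x + e / 2).
  by rewrite lte_fin /= /phi; have := hz0 x; lra.
have hphi : \forall x' \near x, phi x' < phi x + e / 2.
  have /cvgr_lt : phi x' @[x' --> x] --> phi x by exact: cphi.
  by apply; rewrite ltrDl divr_gt0.
case: W0 => -[A B] /= [Az0 Bx] AB.
exists ([set x' | phi x' < phi x + e / 2] `&` B, A) => /=.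
  by split => //; exact: filterI.
move=> [x' z]/= [[hx' Bx'] Az]; have /hW := AB (z, x') (conj Az Bx').
by rewrite lte_fin /= => /ltW; apply: le_trans; rewrite ltW.
Qed.

(** * Measurability with respect to Borel sets of metric spaces *)

Section borel_sets_of_metric_spaces.
Context {R : realType}.

Lemma dense_ball_base (T : pseudoMetricType R) (Q : Type) (s : Q -> T) :
    (forall x e, 0 < e -> exists q, ball (s q) e x) ->
  forall (W : set T) x, open W -> W x -> exists qn : Q * nat,
    ball (s qn.1) qn.2.+1%:R^-1 x /\ ball (s qn.1) qn.2.+1%:R^-1 `<=` W.
Proof.
move=> sdense W x oW Wx.
have /nbhs_ballP[e /= e0 hW] : nbhs x W by exact: open_nbhs_nbhs.
have e20 : 0 < e / 2 by rewrite divr_gt0.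
have [n _ /(_ n (leqnn _)) hn] := near_infty_natSinv_lt (PosNum e20).
have n10 : 0 < n.+1%:R^-1 :> R by rewrite invr_gt0 ltr0n.
have [q hq] := sdense x _ n10.
exists (q, n); split => //= y hy; apply: hW.
have := ball_triangle (ball_sym hq) hy; apply: le_ball.
by rewrite [leRHS]splitr lerD// ltW.
Qed.

(** The Borel sets of [R * V] are those generated by the product topology, and
   not the product of two sigma-algebras; a countable base bridges the gap. *)
Lemma measurable_fun_countable_base dX (X : measurableType dX) (T : pointedType)
    (G : set_system T) (Q : countType) (B : Q -> set T) (D : set X) (v : X -> T) :
    (forall W x, G W -> W x -> exists q, B q x /\ B q `<=` W) ->
    (forall q, measurable (D `&` v @^-1` B q)) ->
  measurable_fun D (v : X -> g_sigma_algebraType G).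
Proof.
move=> B_base mv; apply: (@measurability _ _ X (g_sigma_algebraType G) D v G) => //.
move=> _ [W GW <-].
have -> : D `&` v @^-1` W =
    \bigcup_(q in [set q | B q `<=` W]) (D `&` v @^-1` B q).
  apply/seteqP; split=> [x [Dx Wvx]|x [q /= hW [Dx vx]]]; last first.
    by split => //; exact: hW.
  by have [q [qx qW]] := B_base _ _ GW Wvx; exists q.
rewrite bigcup_mkcond; apply: countable_bigcupT_measurable => [|q].
  exact: countableP.
by case: ifP => // _; exact: mv.
Qed.

Lemma rat_dense (x : R) (e : R) : 0 < e -> exists q : rat, ball (ratr q : R) e x.
Proof.
move=> e0; have [|q] := @rat_in_itvoo R (x - e) (x + e); first by lra.
by rewrite in_itv/= => hq; exists q; rewrite -ball_normE/= ltr_distl.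
Qed.

Lemma rV_rat_dense n (x : 'rV[R]_n.+1) (e : R) : 0 < e ->
  exists q : 'rV[rat]_n.+1, ball (map_mx ratr q : 'rV[R]_n.+1) e x.
Proof.
move=> e0; have /choice[q hq] i := rat_dense (x 0 i) e0.
by exists (\row_i q i); split => // i j; rewrite [i]ord1 !mxE.
Qed.

Lemma continuous_borel_measurable (T : ptopologicalType) (h : T -> R) :
  continuous h -> measurable_fun setT (h : borel T -> R).
Proof.
move=> /continuousP ch; apply: (measurability _ (RGenOpens.measurableE R)).
move=> _ [_ [a [b ->] <-]]; rewrite setTI; apply: sub_sigma_algebra.
exact/ch/interval_open.
Qed.

Variable d : nat.
Local Notation V := 'rV[R]_d.+1.

Lemma measurable_fun_coord (i : 'I_d.+1) :
  measurable_fun setT ((fun y : V => y 0 i) : borel V -> R).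
Proof.
by apply: continuous_borel_measurable; exact: continuous_coord.
Qed.

Context dX (X : measurableType dX).
Implicit Types D : set X.

Lemma measurable_fun_rV D (v : X -> V) : measurable D ->
    (forall i, measurable_fun D (fun x => v x 0 i)) ->
  measurable_fun D (v : X -> borel V).
Proof.
move=> mD mv; apply: (measurable_fun_countable_base
  (dense_ball_base (@rV_rat_dense d))).
move=> [q n] /=; set e := n.+1%:R^-1.
rewrite (_ : _ `&` _ = \bigcap_(i in [set: 'I_d.+1])
    (D `&` (fun x => v x 0 i) @^-1` ball (ratr (q 0 i) : R) e)); last first.
  apply/seteqP; split=> [x [Dx hx] i _|x hx].
    by split => //; have := hx.2 0 i; rewrite mxE.
  split; first exact: (hx 0 I).1.
  by split => [|i j]; [rewrite /e invr_gt0 ltr0n|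
    rewrite [i]ord1 mxE; exact: (hx j I).2].
apply: fin_bigcap_measurable => // i _; apply: mv => //.
exact: measurable_ball.
Qed.

Lemma measurable_fun_pair_borel D (u : X -> R) (v : X -> V) : measurable D ->
    measurable_fun D u -> measurable_fun D (v : X -> borel V) ->
  measurable_fun D ((fun x => (u x, v x)) : X -> borel (R * V)).
Proof.
move=> mD mu mv.
have rat_dense2 (x : R * V) (e : R) : 0 < e -> exists q : rat * 'rV[rat]_d.+1,
    ball ((ratr q.1, map_mx ratr q.2) : R * V) e x.
  move=> e0; have [q hq] := rat_dense x.1 e0.
  by have [r hr] := rV_rat_dense x.2 e0; exists (q, r).
apply: (measurable_fun_countable_base (dense_ball_base rat_dense2)).
move=> [[q r] n] /=; set e := n.+1%:R^-1.
rewrite (_ : _ `&` _ = (D `&` u @^-1` ball (ratr q : R) e) `&`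
    (D `&` v @^-1` ball (map_mx ratr r : V) e)); last first.
  by apply/seteqP; split=> x /= [] => [? []|[? ?] []].
apply: measurableI; first by apply: mu => //; exact: measurable_ball.
by apply: mv => //; apply: sub_sigma_algebra; exact: ball_open.
Qed.

Lemma measurable_dotp D (v w : X -> borel V) :
    measurable_fun D v -> measurable_fun D w ->
  measurable_fun D (fun x => dotp (v x) (w x)).
Proof.
move=> mv mw; apply: (measurable_sum _ (h := fun i x => v x 0 i * w x 0 i)) => i.
by apply: measurable_funM;
  apply: (measurableT_comp (measurable_fun_coord i)).
Qed.

Lemma measurable_enorm D (v : X -> borel V) :
  measurable_fun D v -> measurable_fun D (fun x => enorm (v x)).
Proof.
move=> mv; apply: (measurableT_comp (f := @enorm R d : borel V -> R)) => //.
by apply: continuous_borel_measurable; exact: continuous_enorm.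
Qed.

End borel_sets_of_metric_spaces.

(** * Lebesgue measurable sets *)

Section lebesgue_measurable_sets.
Context {R : realType} {d : nat}.
Local Notation V := 'rV[R]_d.+1.
Local Notation X := (lebRn R d).
Local Notation mu := (lebesgue_Rn R d).

(** A hyperplane orthogonal to an axis cuts a box into two boxes, whose volumes
   add up to the volume of the box. *)
Lemma measurable_half_space (i : 'I_d.+1) (c : R) :
  measurable ([set x : V | x 0 i <= c] : set X).
Proof.
apply: le_caratheodory_measurable => A.
pose lo (ab : V * V) : V * V :=
  (ab.1, \row_j if j == i then Num.min (ab.2 0 j) c else ab.2 0 j).
pose hi (ab : V * V) : V * V :=
  (\row_j (if j == i then Num.max (ab.1 0 j) c else ab.1 0 j), ab.2).
have vol_split ab : box_vol (lo ab) + box_vol (hi ab) = box_vol ab.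
  have bvE cd : box_vol cd = Num.max 0 (cd.2 0 i - cd.1 0 i) *
      \prod_(j | j != i) Num.max 0 (cd.2 0 j - cd.1 0 j).
    by rewrite /box_vol (bigD1 i).
  rewrite !bvE !mxE eqxx.
  have -> : \prod_(j | j != i) Num.max 0 ((lo ab).2 0 j - (lo ab).1 0 j) =
            \prod_(j | j != i) Num.max 0 (ab.2 0 j - ab.1 0 j).
    by apply: eq_bigr => j ji; rewrite mxE (negbTE ji).
  have -> : \prod_(j | j != i) Num.max 0 ((hi ab).2 0 j - (hi ab).1 0 j) =
            \prod_(j | j != i) Num.max 0 (ab.2 0 j - ab.1 0 j).
    by apply: eq_bigr => j ji; rewrite mxE (negbTE ji).
  rewrite -mulrDl; congr (_ * _).
  by rewrite !maxEle !minEle; do ! case: ifPn => //; rewrite -?ltNge; lra.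
apply: le_ereal_inf_tmp => _ [B AB <-].
apply: (@le_trans _ _ (\sum_(k <oo) (box_vol (lo (B k)))%:E +
                       \sum_(k <oo) (box_vol (hi (B k)))%:E)%E).
  apply: leeD; apply: ereal_inf_lbound.
    exists (fun k => lo (B k)) => // x [Ax /= xc].
    have [k _ hk] := AB _ Ax; exists k => // j /=.
    rewrite mxE; have /andP[h1 h2] := hk j; rewrite h1.
    by case: eqP => [->|//]; rewrite le_min xc andbT; have /andP[] := hk i.
  exists (fun k => hi (B k)) => // x [Ax /= /negP]; rewrite -ltNge => xc.
  have [k _ hk] := AB _ Ax; exists k => // j /=.
  rewrite mxE; have /andP[h1 h2] := hk j; rewrite h2 andbT.
  by case: eqP => [->|//]; rewrite gt_max xc andbT; have /andP[] := hk i.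
rewrite -nneseriesD; do ?[by move=> k _ _; rewrite lee_fin box_vol_ge0].
by under eq_eseriesr do rewrite -EFinD vol_split.
Qed.

Lemma measurable_fun_id_borel : measurable_fun setT ((fun x => x) : X -> borel V).
Proof.
apply: measurable_fun_rV; [exact: measurableT|move=> i].
apply: (measurability _ (RGenOInfty.measurableE R)) => _ [_ [c ->] <-].
rewrite setTI (_ : _ @^-1` _ = ~` [set x : V | x 0 i <= c]).
  by apply: measurableC; exact: measurable_half_space.
by apply/seteqP; split=> x /=; rewrite in_itv/= andbT;
  [rewrite leNgt => ->|move/negP; rewrite -ltNge].
Qed.

Lemma measurable_eball r : measurable (eball r : set X).
Proof.
have := measurable_enorm measurable_fun_id_borel.
move=> /(_ measurableT `]-oo, r[%classic (measurable_itv _)).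
by rewrite setTI; congr measurable.
Qed.

Lemma lebesgue_box_lty ab : (mu (box ab) < +oo)%E.
Proof.
apply: (@le_lt_trans _ _ (box_vol ab)%:E); last by rewrite ltry.
pose B k : V * V := if k is 0%N then ab else (0, 0).
apply: ereal_inf_lbound; exists B; first by move=> x abx; exists 0%N => //; exact: abx.
have B0 k : (0 < k)%N -> box_vol (B k) = 0.
  by case: k => // k _; rewrite /B /box_vol big_ord_recl mxE subrr maxxx mul0r.
rewrite (nneseries_recl (f := fun k => (box_vol (B k))%:E)) => [|k _|//]; last first.
  by rewrite lee_fin box_vol_ge0.
by rewrite eseries0 ?adde0// => k k0 _; rewrite B0.
Qed.

Lemma lebesgue_eball_lty r : (mu (eball r) < +oo)%E.
Proof.
apply: le_lt_trans (lebesgue_box_lty (const_mx (- r), const_mx r)).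
apply: le_measure; rewrite ?inE; first exact: measurable_eball.
  rewrite (_ : box _ = \bigcap_(i in [set: 'I_d.+1])
    ([set x : V | x 0 i <= r] `\` [set x : V | x 0 i <= - r])); last first.
    apply/seteqP; split=> [x hx i _ /=|x hx i].
      by have := hx i; rewrite !mxE => /andP[h1 ->];
        split => //; apply/negP; rewrite -ltNge.
    by have [/= h1 /negP] := hx i I; rewrite !mxE -ltNge h1 => ->.
  apply: fin_bigcap_measurable => // i _.
  by apply: measurableD; exact: measurable_half_space.
move=> x /= xr i; rewrite !mxE.
have := le_lt_trans (coord_le_enorm x i) xr.
by rewrite ltr_norml => /andP[-> /ltW].
Qed.

End lebesgue_measurable_sets.

(** * Uniform integrability on spaces of infinite measure *)

Lemma cvge_lt_near {R : realType} (f : nat -> \bar R) (l e : \bar R) :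
  f n @[n --> \oo] --> l -> (l < e)%E -> \forall n \near \oo, (f n < e)%E.
Proof.
move=> fl le; apply: (fl [set y | (y < e)%E]); apply: open_nbhs_nbhs.
by split => //; exact: open_ereal_lt_ereal.
Qed.

Section uniform_integrability.
Context {R : realType} {dX : measure_display} {X : measurableType dX}.
Variable mu : {measure set X -> \bar R}.
Implicit Types (g h : nat -> X -> R) (k : X -> R) (E D : set X).

Definition nneg_meas k := measurable_fun setT k /\ forall x, 0 <= k x.

Lemma nneg_meas_fun E k : nneg_meas k -> measurable_fun E (fun x => (k x)%:E).
Proof. by move=> [mk _]; apply/measurable_EFinP; exact: measurable_funTS. Qed.

Lemma nneg_meas_ge0 E k : nneg_meas k -> forall x, E x -> (0 <= (k x)%:E)%E.
Proof. by move=> [_ k0] x _; rewrite lee_fin. Qed.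

Lemma nneg_measD (k1 k2 : X -> R) : nneg_meas k1 -> nneg_meas k2 ->
  nneg_meas (fun x => k1 x + k2 x).
Proof.
by move=> [m1 p1] [m2 p2]; split=> [|x]; [exact: measurable_funD|exact: addr_ge0].
Qed.

Lemma nneg_measM (k1 k2 : X -> R) : nneg_meas k1 -> nneg_meas k2 ->
  nneg_meas (fun x => k1 x * k2 x).
Proof.
by move=> [m1 p1] [m2 p2]; split=> [|x]; [exact: measurable_funM|exact: mulr_ge0].
Qed.

Lemma nneg_measZ (c : R) k : 0 <= c -> nneg_meas k -> nneg_meas (fun x => c * k x).
Proof. by move=> c0; apply: nneg_measM; split => //; exact: measurable_cst. Qed.

Lemma nneg_meas_powR k (p : R) : measurable_fun setT k -> nneg_meas (fun x => k x `^ p).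
Proof.
by move=> mk; split=> [|x]; [exact: (measurableT_comp (measurable_powR p) mk)|
  exact: powR_ge0].
Qed.

Lemma nneg_meas_indic E : measurable E -> nneg_meas (\1_E : X -> R).
Proof. by move=> mE; split => //; exact: measurable_indic. Qed.

Lemma nneg_meas_le E k1 k2 : measurable E -> nneg_meas k1 -> nneg_meas k2 ->
  (forall x, E x -> k1 x <= k2 x) ->
  (\int[mu]_(x in E) (k1 x)%:E <= \int[mu]_(x in E) (k2 x)%:E)%E.
Proof.
move=> mE p1 p2 k12.
by apply: ge0_le_integral => //;
  do ?[exact: nneg_meas_ge0|exact: nneg_meas_fun|exact: k12].
Qed.

Lemma nneg_meas_intD E k1 k2 : measurable E -> nneg_meas k1 -> nneg_meas k2 ->
  (\int[mu]_(x in E) (k1 x + k2 x)%:E =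
   \int[mu]_(x in E) (k1 x)%:E + \int[mu]_(x in E) (k2 x)%:E)%E.
Proof.
move=> mE p1 p2; under eq_integral do rewrite EFinD.
by apply: ge0_integralD => //; do ?[exact: nneg_meas_ge0|exact: nneg_meas_fun].
Qed.

Lemma nneg_meas_intZ E (c : R) k : measurable E -> 0 <= c -> nneg_meas k ->
  (\int[mu]_(x in E) (c * k x)%:E = c%:E * \int[mu]_(x in E) (k x)%:E)%E.
Proof.
move=> mE c0 p1; under eq_integral do rewrite EFinM.
by apply: ge0_integralZl => //; do ?[exact: nneg_meas_ge0|exact: nneg_meas_fun].
Qed.

Lemma nneg_meas_intS E D k : measurable E -> measurable D -> E `<=` D -> nneg_meas k ->
  (\int[mu]_(x in E) (k x)%:E <= \int[mu]_(x in D) (k x)%:E)%E.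
Proof.
move=> mE mD ED pk.
by apply: ge0_subset_integral => //; [exact: nneg_meas_fun|exact: nneg_meas_ge0].
Qed.

(** Uniform integrability on a space of possibly infinite measure: a set of
   finite measure carries all the mass up to [e], uniformly for large [n].
   Tightness and equi-integrability are thus a single condition. *)
Definition unif_integrable g := forall e : R, 0 < e ->
  exists D (del : R), [/\ measurable D, (mu D < +oo)%E, 0 < del &
    \forall n \near \oo, forall E, measurable E -> (mu (E `&` D) <= del%:E)%E ->
      (\int[mu]_(x in E) (g n x)%:E <= e%:E)%E].

Lemma unif_integrable_le g h : (forall n, nneg_meas (g n)) ->
  (forall n, nneg_meas (h n)) -> (forall n x, g n x <= h n x) ->
  unif_integrable h -> unif_integrable g.
Proof.
move=> pg ph gh uh e /uh[D [del [mD Dfin del0 hn]]].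
exists D, del; split => //; apply: filterS hn => n hn E mE ED.
by apply: le_trans (hn E mE ED); exact: nneg_meas_le.
Qed.

Lemma unif_integrableD g h : (forall n, nneg_meas (g n)) ->
  (forall n, nneg_meas (h n)) -> unif_integrable g -> unif_integrable h ->
  unif_integrable (fun n x => g n x + h n x).
Proof.
move=> pg ph ug uh e e0; have e20 : 0 < e / 2 by rewrite divr_gt0.
have [D1 [d1 [mD1 Dfin1 d10 h1]]] := ug _ e20.
have [D2 [d2 [mD2 Dfin2 d20 h2]]] := uh _ e20.
exists (D1 `|` D2), (Num.min d1 d2); split => //.
- exact: measurableU.
- by apply: le_lt_trans (measureU2 _ _ _) _ => //; exact: lte_add_pinfty.
- by rewrite lt_min d10.
apply: filterS2 h1 h2 => n h1 h2 E mE ED.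
rewrite nneg_meas_intD// [e]splitr EFinD; apply: leeD.
  apply: h1 => //; apply: (@le_trans _ _ (mu (E `&` (D1 `|` D2)))).
    apply: le_measure; rewrite ?inE; do ?exact: measurableI.
      by apply: measurableI => //; exact: measurableU.
    by apply: setIS; exact: subsetUl.
  by apply: le_trans ED _; rewrite lee_fin ge_min lexx.
apply: h2 => //; apply: (@le_trans _ _ (mu (E `&` (D1 `|` D2)))).
  apply: le_measure; rewrite ?inE; do ?exact: measurableI.
    by apply: measurableI => //; exact: measurableU.
  by apply: setIS; exact: subsetUr.
by apply: le_trans ED _; rewrite lee_fin ge_min lexx orbT.
Qed.

Lemma unif_integrableZ (c : R) g : 0 <= c -> (forall n, nneg_meas (g n)) ->
  unif_integrable g -> unif_integrable (fun n x => c * g n x).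
Proof.
move=> c0 pg ug e e0; have c10 : 0 < c + 1 by rewrite ltr_wpDl.
have [D [del [mD Dfin del0 hn]]] := ug _ (divr_gt0 e0 c10).
exists D, del; split => //; apply: filterS hn => n hn E mE ED.
rewrite nneg_meas_intZ//; apply: (@le_trans _ _ (c%:E * (e / (c + 1))%:E)%E).
  by apply: lee_wpmul2l; [rewrite lee_fin|exact: hn].
rewrite -EFinM lee_fin mulrCA ger_pMr// ler_pdivrMr// mul1r lerDl//.
Qed.

Lemma unif_integrable_cvg0 g : (forall n, nneg_meas (g n)) ->
    (forall e : R, 0 < e -> \forall n \near \oo, (\int[mu]_x (g n x)%:E <= e%:E)%E) ->
  unif_integrable g.
Proof.
move=> pg g0 e e0; exists set0, 1; split => //; first by rewrite measure0 ltry.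
apply: filterS (g0 e e0) => n hn E mE _.
by apply: le_trans hn; exact: nneg_meas_intS.
Qed.

Lemma unif_integrable_cst k : nneg_meas k -> (\int[mu]_x (k x)%:E < +oo)%E ->
  unif_integrable (fun=> k).
Proof.
move=> pk kfin e e0.
(* The mass outside [D j] tends to 0 by dominated convergence, while on [D j],
   of finite measure by Markov's inequality, [k] is bounded. *)
pose D j := [set x | j.+1%:R^-1 < k x] `&` [set x | k x <= j.+1%:R].
have mlev (P : set R) : measurable P -> measurable (k @^-1` P).
  by move=> mP; have := pk.1 measurableT _ mP; rewrite setTI.
have mD j : measurable (D j).
  apply: measurableI.
    have := mlev `]j.+1%:R^-1, +oo[%classic (measurable_itv _).
    by congr measurable; apply/seteqP; split=> x /=; rewrite in_itv/= andbT.
  have := mlev `]-oo, j.+1%:R]%classic (measurable_itv _).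
  by congr measurable; apply/seteqP; split=> x /=; rewrite in_itv.
have Dfin j : (mu (D j) < +oo)%E.
  have j0 : 0 < j.+1%:R^-1 :> R by rewrite invr_gt0 ltr0n.
  have h : (j.+1%:R^-1%:E * mu (D j) <= \int[mu]_x (k x)%:E)%E.
    rewrite -integral_cst//.
    apply: (@le_trans _ _ (\int[mu]_(x in D j) (k x)%:E)%E); last exact: nneg_meas_intS.
    apply: nneg_meas_le => //.
    by move=> x [/= h _]; exact: ltW.
  rewrite ltNge leye_eq; apply/negP => /eqP Doo; move: h.
  rewrite Doo gt0_muley ?lte_fin// leye_eq => /eqP h.
  by rewrite h ltxx in kfin.
pose r j x := k x * \1_(~` D j) x.
have pr j : nneg_meas (r j).
  by apply: nneg_measM => //; apply: nneg_meas_indic; exact: measurableC.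
have r0 : (\int[mu]_x (r j x)%:E @[j --> \oo] --> 0)%E.
  have [|||||_ _] := @dominated_convergence _ X R mu setT measurableT
      (fun j x => (r j x)%:E) (cst 0%E) (fun x => (k x)%:E).
  - by move=> j; exact: nneg_meas_fun.
  - by [].
  - apply: aeW => x _; apply: cvg_near_cst.
    have [k0|kn0] := eqVneq (k x) 0; first by apply: nearW => j; rewrite /r k0 mul0r.
    have k0 : 0 < k x by rewrite lt_neqAle eq_sym kn0 pk.2.
    near=> j; rewrite /r indicE memNset ?mulr0//= => notD; apply: notD; split => /=.
      by near: j; exact: (near_infty_natSinv_lt (PosNum k0)).
    near: j; exists (Num.truncn (k x)) => // j /= hj.
    by rewrite ltW// (lt_le_trans (truncnS_gt _))// ler_nat.
  - apply/integrableP; split; first exact: nneg_meas_fun.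
    by under eq_integral do rewrite gee0_abs ?lee_fin ?pk.2//.
  - apply: aeW => x j _; rewrite gee0_abs ?lee_fin ?(pr j).2//.
    by rewrite /r ler_piMr ?pk.2// indicE lern1 leq_b1.
  by rewrite integral0.
have e20 : 0 < e / 2 by rewrite divr_gt0.
have [j _ /(_ j (leqnn _)) /= hj] :
    \forall j \near \oo, (\int[mu]_x (r j x)%:E < (e / 2)%:E)%E.
  by apply: (cvge_lt_near r0); rewrite lte_fin.
exists (D j), (e / 2 / j.+1%:R); split => //; first by rewrite divr_gt0.
apply: nearW => _ E mE ED.
have pD : nneg_meas (fun x => j.+1%:R * \1_(D j) x).
  exact: (nneg_measZ (ler0n _ _) (nneg_meas_indic (mD j))).
apply: (@le_trans _ _ (\int[mu]_(x in E) (r j x + j.+1%:R * \1_(D j) x)%:E)%E).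
  apply: nneg_meas_le => //; first exact: nneg_measD.
  move=> x _; rewrite /r !indicE in_setC; case: (boolP (x \in D j)) => /= [|_].
    by rewrite inE => -[_ /= h]; rewrite mulr0 add0r mulr1.
  by rewrite mulr1 mulr0 addr0.
rewrite nneg_meas_intD// [e]splitr EFinD; apply: leeD.
  by apply: le_trans (ltW hj); exact: nneg_meas_intS.
rewrite (nneg_meas_intZ _ _ (nneg_meas_indic (mD j)))// integral_indic// setIC.
apply: (@le_trans _ _ (j.+1%:R%:E * (e / 2 / j.+1%:R)%:E)%E).
  by apply: lee_wpmul2l => //; rewrite lee_fin.
by rewrite -EFinM mulrC divfK.
Unshelve. all: by end_near. Qed.

(** Young's inequality [b w <= t^-p' b^p' + t^p w^p] with [t] small trades the
   boundedness of [w] in [L^p] for the uniform integrability of [b^p']. *)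
Lemma unif_integrableM (p p' K : R) (b w : nat -> X -> R) :
    1 < p -> 1 < p' -> p^-1 + p'^-1 = 1 ->
    (forall n, nneg_meas (b n)) -> (forall n, nneg_meas (w n)) ->
    unif_integrable (fun n x => b n x `^ p') ->
    (forall n, (\int[mu]_x (w n x `^ p)%:E <= K%:E)%E) ->
  unif_integrable (fun n x => b n x * w n x).
Proof.
move=> p1 p'1 pp' pb pw ub wK e e0.
have p0 : 0 < p by exact: lt_trans p1.
have p'0 : 0 < p' by exact: lt_trans p'1.
have K0 : 0 <= K.
  rewrite -lee_fin; apply: le_trans (wK 0%N); apply: integral_ge0 => x _.
  by rewrite lee_fin powR_ge0.
pose s := e / 2 / (K + 1); have s0 : 0 < s by rewrite !divr_gt0// ltr_wpDl.
pose t := s `^ p^-1; have t0 : 0 < t by exact: powR_gt0.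
have tps : t `^ p = s by rewrite /t -powRrM mulVf ?gt_eqF// powRr1// ltW.
have c0 : 0 < t `^ p' by exact: powR_gt0.
have [D [del [mD Dfin del0 hn]]] := ub _ (mulr_gt0 c0 (divr_gt0 e0 (ltr0Sn R 1))).
exists D, del; split => //; apply: filterS hn => n hn E mE ED.
have pbp : nneg_meas (fun x => b n x `^ p') by apply: nneg_meas_powR; exact: (pb n).1.
have pwp : nneg_meas (fun x => w n x `^ p) by apply: nneg_meas_powR; exact: (pw n).1.
have ci0 : 0 <= (t `^ p')^-1 by rewrite invr_ge0 ltW.
have pb' := nneg_measZ ci0 pbp; have pw' := nneg_measZ (ltW s0) pwp.
apply: (@le_trans _ _ (\int[mu]_(x in E)
    ((t `^ p')^-1 * b n x `^ p' + s * w n x `^ p)%:E)%E).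
  apply: nneg_meas_le => //; do ?[exact: nneg_measM|exact: nneg_measD].
  move=> x _.
  have -> : b n x * w n x = (b n x / t) * (t * w n x).
    by rewrite mulrA divfK// gt_eqF.
  have b0 := (pb n).2 x; have w0 := (pw n).2 x.
  apply: le_trans (conjugate_powR _ _ p'0 p0 _) _.
  - by rewrite divr_ge0// ltW.
  - by rewrite mulr_ge0// ltW.
  - by rewrite addrC.
  rewrite (powRM p (ltW t0) w0) tps.
  apply: lerD; last first.
    rewrite ler_pdivrMr// ler_peMr ?(ltW p1)// mulr_ge0// ?(ltW s0)// powR_ge0//.
  rewrite powRM ?invr_ge0 ?(ltW t0)//.
  rewrite -(powR_inv1 (ltW t0)) -powRrM mulN1r powRN (mulrC (b n x `^ p')).
  by rewrite ler_pdivrMr// ler_peMr ?(ltW p'1)// mulr_ge0// powR_ge0.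
rewrite nneg_meas_intD// !nneg_meas_intZ ?(ltW s0)// [e]splitr EFinD; apply: leeD.
  apply: (@le_trans _ _ ((t `^ p')^-1%:E * (t `^ p' * (e / 2))%:E)%E).
    by apply: lee_wpmul2l; [rewrite lee_fin|exact: hn].
  by rewrite -EFinM mulKf// gt_eqF.
apply: (@le_trans _ _ (s%:E * K%:E)%E).
  apply: lee_wpmul2l; first by rewrite lee_fin ltW.
  by apply: le_trans (wK n); exact: nneg_meas_intS.
rewrite -EFinM lee_fin /s mulrAC ler_pdivrMr ?ltr_wpDl// ler_wpM2l//.
  by rewrite divr_ge0// ltW.
by rewrite lerDl.
Qed.

End uniform_integrability.

(** * Almost everywhere limits and measurable selections *)

Section almost_everywhere_limits.
Context {R : realType} {dX : measure_display} {X : measurableType dX}.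
Variable mu : {measure set X -> \bar R}.

(** A set of finite measure in which the [Z n] live makes the convergence to 0 of
   their indicators dominated. *)
Lemma mu_eventually_avoided (D : set X) (Z : nat -> set X) (del : R) :
    measurable D -> (mu D < +oo)%E -> (forall n, measurable (Z n)) ->
    (forall n, Z n `<=` D) -> {ae mu, forall x, \forall n \near \oo, ~ Z n x} ->
    0 < del ->
  \forall n \near \oo, (mu (Z n) <= del%:E)%E.
Proof.
move=> mD Dfin mZ ZD Z_ev del0.
have [|||||_ _] := @dominated_convergence _ X R mu D mD
    (fun n x => (\1_(Z n) x)%:E) (cst 0%E) (cst 1%E).
- by move=> n; apply/measurable_EFinP; exact: measurable_indic.
- exact: measurable_cst.
- apply: filterS Z_ev => x hx _; apply: cvg_near_cst.
  by apply: filterS hx => n hn; rewrite indicE memNset.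
- apply/integrableP; split; first exact: measurable_cst.
  under eq_integral do rewrite /= normr1.
  by rewrite integral_cst// mul1e.
- by apply: aeW => x n _ /=; rewrite lee_fin ger0_norm.
rewrite integral0 => h.
have : (0 < del%:E)%E by rewrite lte_fin.
move=> /(cvge_lt_near h); apply: filterS => n /= /ltW.
by rewrite integral_indic// setIidl.
Qed.

(** The sum of the series [h n] has a finite integral, hence is finite almost
   everywhere. *)
Lemma summable_integrals_ae_cvg0 (h : nat -> X -> R) :
    (forall n, nneg_meas (h n)) ->
    (forall n, (\int[mu]_x (h n x)%:E <= (1 / (2 ^ n.+1)%:R)%:E)%E) ->
  {ae mu, forall x, h n x @[n --> \oo] --> 0}.
Proof.
move=> ph hle; pose S x := (\sum_(n <oo) (h n x)%:E)%E.
have intS : mu.-integrable setT S.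
  apply/integrableP; split.
    apply: ge0_emeasurable_sum => [n x _ _|n _]; first by rewrite lee_fin (ph n).2.
    exact: nneg_meas_fun.
  have S0 x : (0 <= S x)%E by apply: nneseries_ge0 => n _ _; rewrite lee_fin (ph n).2.
  have -> : (\int[mu]_x `|S x| = \int[mu]_x S x)%E.
    by apply: eq_integral => x _; rewrite gee0_abs.
  rewrite integral_nneseries//; last 2 first.
  - by move=> n; exact: nneg_meas_fun.
  - by move=> n x _; rewrite lee_fin (ph n).2.
  apply: (@le_lt_trans _ _ (\sum_(n <oo) (1 / (2 ^ n.+1)%:R)%:E)%E).
    apply: lee_nneseries => n _; last exact: hle.
    move=> _.
    by apply: integral_ge0 => x _; rewrite lee_fin (ph n).2.
  rewrite (_ : (\sum_(n <oo) _)%E = 1%E) ?ltry//.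
  have /cvg_lim := @cvg_geometric_eseries_half R 1 0.
  rewrite expr0 divr1 => <- //; congr (limn _).
  by apply/funext => n; rewrite /eseries; apply: eq_bigr => k _; rewrite addn1.
apply: filterS (integrable_ae measurableT intS) => x /(_ I) Sfin.
have h0 n : (0 <= (h n x)%:E)%E by rewrite lee_fin (ph n).2.
have Slty : (\sum_(0 <= n <oo | true) (h n x)%:E < +oo)%E.
  by move: Sfin; rewrite fin_numE => /andP[_]; rewrite -ltey.
have tail0 := nneseries_tail_cvg Slty (fun n _ => h0 n).
have : ((h n x)%:E @[n --> \oo] --> 0)%E.
  apply: squeeze_cvge tail0; last exact: cvg_cst.
  apply: nearW => n; rewrite h0/=.
  rewrite (nneseries_split n 1)//.
  rewrite addn1 big_nat1 leeDl//.
  by apply: nneseries_ge0 => k _ _; exact: h0.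
by move=> /fine_cvgP[].
Qed.

Lemma measurable_finite_cover (A : nat -> set X) (D : set X) (del : R) :
    measurable D -> (mu D < +oo)%E -> (forall i, measurable (A i)) -> 
    {ae mu, forall x, exists i, A i x} -> 0 < del ->
  exists n, (mu (D `\` \bigcup_(i < n) A i) <= del%:E)%E.
Proof.
move=> mD Dfin mA A_cover del0.
have [|||n _ hn] := @mu_eventually_avoided D
  (fun n => D `\` \bigcup_(i < n) A i) _ mD Dfin _ _ _ del0.
- by move=> n; apply: measurableD => //; exact: bigcup_measurable.
- by move=> n x [].
- apply: filterS A_cover => x [i Ai]; exists i.+1 => // n /= hn [_]; apply.
  by exists i.
- by exists n; exact: (hn n (leqnn n)).
Qed.

(** Merging finitely many cells: on the [n]-th partial union, every point picks
   one of the cells containing it, in a measurable way. *)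
Lemma measurable_selection (dY : measure_display) (Y : measurableType dY)
    (A : nat -> set X) (c : nat -> Y) n : (forall i, measurable (A i)) ->
  exists s : X -> Y, [/\ measurable_fun setT s,
    (forall x, (\bigcup_(i < n) A i) x -> exists i, [/\ (i < n)%N, A i x & s x = c i]) &
    forall x, exists2 i, (i <= n)%N & s x = c i].
Proof.
move=> mA; elim: n => [|n [s [ms sA sc]]].
  by exists (cst (c 0%N)); split => // [x []//|x]; exists 0%N.
exists (fun x => if x \in A n then c n else s x); split.
- apply: measurable_fun_ifT => //.
  apply: (measurable_fun_bool true); rewrite setTI.
  rewrite (_ : _ @^-1` _ = A n)//.
  by apply/seteqP; split => x /=; [move/set_mem|move/mem_set].
- move=> x [i /= ilt Ai]; case: ifPn => [/set_mem An|]; first by exists n.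
  move=> /negP nA; have [|j [jn Aj sj]] := sA x.
    exists i => //=; move: ilt; rewrite ltnS leq_eqVlt => /predU1P[ein|//].
    by exfalso; apply: nA; rewrite -ein inE.
  by exists j; split => //; exact: ltnW.
- move=> x; case: ifP => _; first by exists n.
  by have [i ilen si] := sc x; exists i => //; exact: leqW.
Qed.

End almost_everywhere_limits.

(** * Duality and uniform boundedness in [L^p] *)

Section gliding_signs.
Context {R : realType}.

(** One of [x + y] and [x - y] is at least as large as [y]: choose the signs one
   after the other, the [k]-th one looking at the [k]-th column only. *)
Lemma sign_choice (a : nat -> nat -> R) : exists s : nat -> R, forall k,
  `|s k| = 1 /\ `|a k k| <= `|\sum_(j < k.+1) s j * a j k|.
Proof.
pose sg (x y : R) : R := if 0 <= x * y then 1 else -1.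
pose S := fix S k : nat -> R := if k is k'.+1 then
  fun i => S k' i + sg (S k' k') (a k' k') * a k' i else fun=> 0.
pose s k := sg (S k k) (a k k).
have SE k i : S k i = \sum_(j < k) s j * a j i.
  by elim: k => [|k ih]; rewrite ?big_ord0// big_ord_recr/= -ih.
exists s => k; split; first by rewrite /s /sg; case: ifP => _; rewrite ?normrN normr1.
rewrite -SE /= -(ler_pXn2r (ltn0Sn 1)) ?nnegrE// !real_normK ?num_real//.
rewrite sqrrD /sg; case: ifPn => [h|].
  by rewrite mul1r -mulr_natr; have := sqr_ge0 (S k k); lra.
rewrite -ltNge mulN1r sqrrN -mulr_natr => h; have := sqr_ge0 (S k k); lra.
Qed.

End gliding_signs.

Section duality.
Context {R : realType} {d : nat} {dX : measure_display} {X : measurableType dX}.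
Variable mu : {measure set X -> \bar R}.
Local Notation V := 'rV[R]_d.+1.
Implicit Types v w b : X -> borel V.

(** The spaces [Lp_vec], their norm and their dual over an arbitrary measure, none of
   the arguments being specific to Lebesgue measure. *)
Definition Lpv (p : R) v := measurable_fun setT v /\
  (\int[mu]_x (enorm (v x) `^ p)%:E < +oo)%E.

Definition Lpv_norm (p : R) v : R :=
  fine ((\int[mu]_x (enorm (v x) `^ p)%:E) `^ p^-1)%E.

Definition bounded_linear (p : R) (L : (X -> borel V) -> R) :=
  (forall a v w, Lpv p v -> Lpv p w ->
     L (fun x => a *: (v x : V) + (w x : V)) = a * L v + L w) /\
  exists K : R, forall v, Lpv p v -> `|L v| <= K * Lpv_norm p v.

Lemma nneg_meas_enorm v (r : R) : measurable_fun setT v ->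
  nneg_meas (fun x => enorm (v x) `^ r).
Proof. by move=> mv; apply: nneg_meas_powR; exact: measurable_enorm. Qed.

Lemma Lpv_norm_ge0 p v : 0 <= Lpv_norm p v.
Proof. exact/fine_ge0/poweR_ge0. Qed.

Lemma Lpv_normE p v : Lpv p v ->
  ((\int[mu]_x (enorm (v x) `^ p)%:E) `^ p^-1 = (Lpv_norm p v)%:E)%E.
Proof.
by move=> [_ vfin]; rewrite /Lpv_norm fineK// ge0_fin_numE ?poweR_ge0// poweR_lty.
Qed.

Lemma Lpv_norm_integral p v : p != 0 -> Lpv p v ->
  (\int[mu]_x (enorm (v x) `^ p)%:E = (Lpv_norm p v `^ p)%:E)%E.
Proof.
move=> p0 Lv; rewrite -poweR_EFin -Lpv_normE// -poweRrM mulVf// poweRe1//.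
by apply: integral_ge0 => x _; rewrite lee_fin powR_ge0.
Qed.

Lemma Lnorm_enorm p v : Lpv p v ->
  Lnorm mu p%:E (EFin \o (fun x => enorm (v x))) = (Lpv_norm p v)%:E.
Proof.
move=> Lv; rewrite -(Lpv_normE Lv) unlock; apply: (congr1 (fun y => y `^ p^-1)%E).
by apply: eq_integral => x _ /=; rewrite ger0_norm ?enorm_ge0.
Qed.

Section pairing.
Variables (p p' : R) (b : X -> borel V).
Hypotheses (p0 : 0 < p) (p'0 : 0 < p') (pp' : p^-1 + p'^-1 = 1).
Hypothesis mb : measurable_fun setT b.
Hypothesis bfin : (\int[mu]_x (enorm (b x) `^ p')%:E < +oo)%E.

Definition pairing w : R := \int[mu]_x dotp (b x) (w x).

Let hoelder_vec w : Lpv p w ->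
  (\int[mu]_x `|(dotp (b x) (w x))%:E| <= (Lpv_norm p' b * Lpv_norm p w)%:E)%E.
Proof.
move=> Lw; have mw := Lw.1.
have mbw : nneg_meas (fun x => enorm (b x) * enorm (w x)).
  by split=> [|x]; [apply: measurable_funM; exact: measurable_enorm|
    rewrite mulr_ge0 ?enorm_ge0].
apply: (@le_trans _ _ (\int[mu]_x (enorm (b x) * enorm (w x))%:E)%E).
  under eq_integral do rewrite abse_EFin.
  apply: nneg_meas_le => // [|x _]; last exact: cauchy_schwarz.
  split=> [|x]; last exact: normr_ge0.
  by apply: measurableT_comp => //; exact: measurable_dotp.
have := @hoelder _ X R mu (fun x => enorm (b x)) (fun x => enorm (w x)) p' p
  (measurable_enorm mb) (measurable_enorm mw) p'0 p0 _.
rewrite addrC pp' => /(_ erefl).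
rewrite Lnorm1 (Lnorm_enorm (conj mb bfin : Lpv p' b)) (Lnorm_enorm Lw).
rewrite -EFinM; apply: le_trans; rewrite le_eqVlt; apply/orP; left.
apply/eqP; apply: eq_integral => x _ /=.
by rewrite ger0_norm// mulr_ge0 ?enorm_ge0.
Qed.

Lemma pairing_integrable w : Lpv p w ->
  mu.-integrable setT (fun x => (dotp (b x) (w x))%:E).
Proof.
move=> Lw; apply/integrableP; split.
  by apply/measurable_EFinP; apply: measurable_dotp => //; exact: Lw.1.
by apply: le_lt_trans (hoelder_vec Lw) _; rewrite ltry.
Qed.

Lemma pairing_bound w : Lpv p w -> `|pairing w| <= Lpv_norm p' b * Lpv_norm p w.
Proof.
move=> Lw; have ibw := pairing_integrable Lw.
rewrite -lee_fin; apply: le_trans (hoelder_vec Lw).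
have /= -> := @EFin_normr_Rintegral _ X R mu setT
  (fun x => dotp (b x) (w x)) measurableT ibw.
by apply: le_abse_integral => //; exact: measurable_int ibw.
Qed.

Lemma pairing_dual : bounded_linear p pairing.
Proof.
split=> [a v w Lv Lw|]; last first.
  by exists (Lpv_norm p' b) => w Lw; exact: pairing_bound.
rewrite /pairing.
under eq_Rintegral do rewrite dotpDr dotpZr.
rewrite RintegralD//; last exact: pairing_integrable.
  by rewrite RintegralZl//; exact: pairing_integrable.
exact: (integrableZl measurableT a (pairing_integrable Lv)).
Qed.

End pairing.

(** The extremal case of Hoelder's inequality: pair with [|v|^(p-2) v], normalised
   in [L^p']. *)
Lemma norming_functional p v : 1 < p -> Lpv p v -> exists L : (X -> borel V) -> R,
  [/\ bounded_linear p L, (forall w, Lpv p w -> `|L w| <= Lpv_norm p w) &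
      L v = Lpv_norm p v].
Proof.
move=> p1 Lv; have p0 : 0 < p by exact: lt_trans p1.
have mv := Lv.1; have [N0|Nn0] := eqVneq (Lpv_norm p v) 0.
  exists (fun=> 0); split => [|w _|//].
  - split=> [*|]; first by rewrite mulr0 addr0.
    by exists 0 => w _; rewrite normr0 mul0r.
  - by rewrite normr0 Lpv_norm_ge0.
have Npos : 0 < Lpv_norm p v by rewrite lt_neqAle eq_sym Nn0 Lpv_norm_ge0.
pose p' := p / (p - 1).
have pm1 : 0 < p - 1 by rewrite subr_gt0.
have p'0 : 0 < p' by rewrite divr_gt0.
have pp' : p^-1 + p'^-1 = 1.
  by rewrite /p'; field; rewrite !gt_eqF//.
(* Dividing by [enorm (v x)] through the power -1 keeps [c] measurable, and gives
   the right value 0 where [v x = 0]. *)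
pose c x := enorm (v x) `^ (p - 1) * enorm (v x) `^ (-1) / Lpv_norm p v `^ (p - 1).
pose b : X -> borel V := fun x => c x *: (v x : V).
have c0 x : 0 <= c x by rewrite divr_ge0 ?mulr_ge0 ?powR_ge0.
have cv x : c x * enorm (v x) = (enorm (v x) / Lpv_norm p v) `^ (p - 1).
  rewrite powRM ?invr_ge0 ?enorm_ge0 ?Lpv_norm_ge0//.
  have -> : (Lpv_norm p v)^-1 `^ (p - 1) = (Lpv_norm p v `^ (p - 1))^-1.
    by rewrite -powR_inv1 ?Lpv_norm_ge0// -powRrM mulN1r powRN.
  rewrite /c mulrAC powR_inv1 ?enorm_ge0//; congr (_ * _).
  have [e0|en0] := eqVneq (enorm (v x)) 0; last by rewrite divfK.
  by rewrite e0 mulr0 powR0// gt_eqF.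
have mb : measurable_fun setT b.
  apply: measurable_fun_rV => // i; under eq_fun do rewrite mxE.
  apply: measurable_funM; last exact: (measurableT_comp (measurable_fun_coord i) mv).
  apply: measurable_funM; last exact: measurable_cst.
  by apply: measurable_funM; exact: (nneg_meas_enorm _ mv).1.
have bE x : enorm (b x) = c x * enorm (v x).
  by rewrite /b enormZ ger0_norm.
have vNp : (\int[mu]_x ((enorm (v x) / Lpv_norm p v) `^ p)%:E = 1)%E.
  have Ni0 : 0 <= (Lpv_norm p v)^-1 by rewrite invr_ge0 Lpv_norm_ge0.
  transitivity (\int[mu]_x ((Lpv_norm p v)^-1 `^ p * enorm (v x) `^ p)%:E)%E.
    by apply: eq_integral => x _; rewrite mulrC powRM ?enorm_ge0.
  rewrite (nneg_meas_intZ _ _ (powR_ge0 _ _) (nneg_meas_enorm p mv))//.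
  rewrite (Lpv_norm_integral _ Lv) ?gt_eqF// -EFinM -powRM// ?Lpv_norm_ge0//.
  by rewrite mulVf// powR1.
have bint : (\int[mu]_x (enorm (b x) `^ p')%:E = 1)%E.
  rewrite -vNp; apply: eq_integral => x _; rewrite bE cv -powRrM.
  by rewrite (_ : (p - 1) * p' = p)// /p' mulrC divfK// gt_eqF.
exists (pairing b); split.
- by apply: (pairing_dual p0 p'0 pp' mb); rewrite bint ltry.
- have Nb : Lpv_norm p' b = 1 by rewrite /Lpv_norm bint poweR1r.
  move=> w Lw; have := pairing_bound p0 p'0 pp' mb _ Lw.
  by rewrite Nb mul1r; apply; rewrite bint ltry.
- rewrite /pairing /Rintegral.
  have -> : (\int[mu]_x (dotp (b x) (v x))%:E =
      \int[mu]_x (Lpv_norm p v * (enorm (v x) / Lpv_norm p v) `^ p)%:E)%E.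
    apply: eq_integral => x _; congr EFin.
    rewrite /b dotpZl -sqr_enorm expr2 mulrA cv.
    have y0 : 0 <= enorm (v x) / Lpv_norm p v.
      by rewrite divr_ge0 ?enorm_ge0 ?Lpv_norm_ge0.
    rewrite (_ : (_ / _) `^ p =
        (enorm (v x) / Lpv_norm p v) `^ (p - 1) * (enorm (v x) / Lpv_norm p v)).
      by rewrite mulrCA; congr (_ * _); rewrite mulrC divfK.
    move: (_ / _) y0 => y y0; rewrite -[in LHS](subrK 1 p) powRD.
      by rewrite powRr1.
    by rewrite subrK gt_eqF.
  rewrite nneg_meas_intZ ?Lpv_norm_ge0//; first by rewrite vNp mule1.
  apply: nneg_meas_powR; apply: measurable_funM; last exact: measurable_cst.
  exact: measurable_enorm.
Qed.

(** Uniform boundedness, by the gliding hump: if the norms of the [v n] were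
   unbounded, a series [\sum_k +-3^-k L_k] of functionals norming a fast growing
   subsequence would be unbounded on it. The signs make the partial sum of index
   [k] large at the [k]-th term, and the tail of the series, being at most half of
   it, cannot destroy that. *)
Lemma pointwise_bounded_norm_bounded p (v : nat -> X -> borel V) : 1 < p ->
    (forall n, Lpv p (v n)) ->
    (forall L, bounded_linear p L -> exists M, forall n, `|L (v n)| <= M) ->
  exists K, forall n, Lpv_norm p (v n) <= K.
Proof.
move=> p1 Lv v_bd; apply: contrapT => unbd.
have {}unbd k : exists n, 2 * 3 ^+ k * k.+1%:R <= Lpv_norm p (v n).
  apply: contrapT => h; apply: unbd; exists (2 * 3 ^+ k * k.+1%:R) => n.
  by rewrite leNgt; apply/negP => hn; apply: h; exists n; exact: ltW.
have [m hm] := choice unbd.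
have [L hL] := choice (fun k => norming_functional p1 (Lv (m k))).
pose z : R := 3^-1.
have z0 : 0 < z by rewrite invr_gt0.
have z1 : `|z| < 1 by rewrite gtr0_norm// invf_lt1// ltr1n.
have [s hs] := sign_choice (fun j k => z ^+ j * L j (v (m k))).
pose u w k : R := s k * (z ^+ k * L k w).
have uN w k : Lpv p w -> `|u w k| <= z ^+ k * Lpv_norm p w.
  move=> Lw; rewrite /u normrM (hs k).1 mul1r normrM ger0_norm ?exprn_ge0 ?(ltW z0)//.
  by rewrite ler_wpM2l ?exprn_ge0 ?(ltW z0)//; have [_ h _] := hL k; exact: h.
(* The terms of index larger than [k] sum up to at most
   [\sum_(j > k) 3^-j = 3^-k / 2]. *)
have tail w k n : Lpv p w ->
    `|\sum_(j < k.+1 + n) u w j - \sum_(j < k.+1) u w j| <=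
    z ^+ k / 2 * Lpv_norm p w * (1 - z ^+ n).
  move=> Lw; elim: n => [|n ih]; first by rewrite addn0 subrr normr0 expr0 subrr mulr0.
  rewrite addnS big_ord_recr/= addrAC; apply: le_trans (ler_normD _ _) _.
  apply: (@le_trans _ _ (z ^+ k / 2 * Lpv_norm p w * (1 - z ^+ n) +
      z ^+ (k.+1 + n) * Lpv_norm p w)).
    by apply: lerD => //; exact: uN.
  by rewrite exprD !exprS le_eqVlt; apply/orP; left; apply/eqP; rewrite /z; field.
have cvg_u w : Lpv p w -> cvgn (series (u w)).
  move=> Lw; apply: normed_cvg.
  apply: (@series_le_cvg R _ (geometric (Lpv_norm p w) z)).
  - by move=> k; exact: normr_ge0.
  - by move=> k; rewrite /geometric/= mulr_ge0 ?Lpv_norm_ge0 ?exprn_ge0 ?(ltW z0).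
  - by move=> k; rewrite /geometric/= mulrC; exact: uN.
  - exact: is_cvg_geometric_series.
pose Lam w : R := limn (series (u w)).
have seriesE w k : series (u w) k = \sum_(j < k) u w j by rewrite /series/= big_mkord.
have lim_tail w k : Lpv p w ->
    `|Lam w - \sum_(j < k.+1) u w j| <= z ^+ k / 2 * Lpv_norm p w.
  move=> Lw; set S := \sum_(j < k.+1) _.
  have h : `|series (u w) n - S| @[n --> \oo] --> `|Lam w - S|.
    by apply: cvg_norm; apply: cvgB; [exact: cvg_u|exact: cvg_cst].
  rewrite -(cvg_lim _ h)//; apply: limr_le; first by apply/cvg_ex; exists `|Lam w - S|.
  exists k.+1 => // n /= /subnKC <-; rewrite seriesE; apply: le_trans (tail w k _ Lw) _.
  rewrite ler_piMr// ?gerBl ?exprn_ge0 ?(ltW z0)//.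
  by rewrite mulr_ge0 ?Lpv_norm_ge0// divr_ge0 ?exprn_ge0 ?(ltW z0).
have lam_dual : bounded_linear p Lam.
  split=> [a w1 w2 L1 L2|].
    apply: cvg_lim => //.
    rewrite (_ : series _ = (a \*: series (u w1)) \+ series (u w2)).
      by apply: cvgD; [apply: cvgZr; exact: cvg_u|exact: cvg_u].
    apply/funext => k /=; rewrite !seriesE scaler_sumr -big_split/=.
    apply: eq_bigr => j _; rewrite /u; have [[-> //]] := hL j.
    by move=> _ _ _; rewrite /GRing.scale/=; ring.
  exists (3 / 2) => w Lw; have := lim_tail w 0%N Lw; have := uN w 0%N Lw.
  rewrite big_ord1 expr0 => h1 h2.
  rewrite -[Lam w](subrK (u w 0%N)); apply: le_trans (ler_normD _ _) _.
  by lra.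
have [M hM] := v_bd _ lam_dual.
have big k : k.+1%:R <= `|Lam (v (m k))|.
  have h1 := lim_tail (v (m k)) k (Lv _).
  have := (hs k).2; have [_ _ ->] := hL k.
  rewrite ger0_norm ?mulr_ge0 ?exprn_ge0 ?Lpv_norm_ge0 ?(ltW z0)// -/(u _ _) => h2.
  have h3 : k.+1%:R <= z ^+ k / 2 * Lpv_norm p (v (m k)).
    apply: le_trans (ler_wpM2l _ (hm k)); last first.
      by rewrite divr_ge0 ?exprn_ge0 ?(ltW z0).
    rewrite /z exprVn le_eqVlt; apply/orP; left; apply/eqP; field.
    by rewrite expf_neq0.
  have := ler_normB (Lam (v (m k))) (Lam (v (m k)) - \sum_(j < k.+1) u (v (m k)) j).
  rewrite subKr; lra.
have [k hk] : exists k : nat, M < k.+1%:R.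
  by exists (Num.truncn M); exact: truncnS_gt.
by have := le_trans (big k) (hM (m k)); rewrite leNgt hk.
Qed.

End duality.

(** * Comparison of integrals *)

Section integral_comparison.
Context {R : realType} {dX : measure_display} {X : measurableType dX}.
Variable mu : {measure set X -> \bar R}.

(** The upper function need not be integrable: its negative part is dominated. *)
Lemma integrable_ae_le_integral (D : set X) (g h : X -> R) : measurable D ->
    mu.-integrable D (EFin \o g) -> measurable_fun D h ->
    {ae mu, forall x, D x -> g x <= h x} ->
  (\int[mu]_(x in D) (g x)%:E <= \int[mu]_(x in D) (h x)%:E)%E.
Proof.
move=> mD ig mh gh; have mg := measurable_int _ ig.
have mh' : measurable_fun D (EFin \o h) by exact/measurable_EFinP.
rewrite [leLHS]integralE [leRHS]integralE; apply: leeB.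
  apply: ae_ge0_le_integral => //; do ?exact: measurable_funepos.
  apply: filterS gh => x gh Dx.
  by rewrite !funeposE /= -!EFin_max lee_fin ge_max !le_max gh// lexx orbT.
apply: ae_ge0_le_integral => //; do ?exact: measurable_funeneg.
apply: filterS gh => x gh Dx.
by rewrite !funenegE /= -!EFin_max lee_fin ge_max !le_max lerN2 gh// lexx orbT.
Qed.

Lemma nneg_meas_integrable (k : X -> R) : nneg_meas k ->
  (\int[mu]_x (k x)%:E < +oo)%E -> mu.-integrable setT (EFin \o k).
Proof.
move=> pk kfin; apply/integrableP; split; first exact: nneg_meas_fun.
have -> : (\int[mu]_x `|(EFin \o k) x| = \int[mu]_x (k x)%:E)%E.
  by apply: eq_integral => x _; rewrite gee0_abs// lee_fin pk.2.
by [].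
Qed.

Lemma nneg_meas_int_indic (k : X -> R) (E : set X) : measurable E ->
  (\int[mu]_x (\1_E x * k x)%:E = \int[mu]_(x in E) (k x)%:E)%E.
Proof.
move=> mE; rewrite [RHS]integral_mkcond; apply: eq_integral => x _.
rewrite /patch indicE; case: ifP => _; first by rewrite mul1r.
by rewrite mul0r.
Qed.

End integral_comparison.

(** * Measurable choice of affine minorants *)

Section affine_selection.
Context {R : realType} {d : nat} {dX : measure_display} {X : measurableType dX}.
Variable mu : {measure set X -> \bar R}.
Local Notation V := 'rV[R]_d.+1.
Local Notation Q := (rat * 'rV[rat]_d.+1)%type.

(** At every point there is an affine [e]-minorant with rational coefficients, up to
   an error linear in [xi]. The countably many candidates cut the space into cells,
   finitely many of which fill [D] up to measure [del]; this bounds the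
   coefficients. *)
Lemma affine_selection (g : X -> V -> R) (v : X -> borel V) (D : set X) (e del : R) :
    measurable D -> (mu D < +oo)%E -> 0 < e -> 0 < del ->
    (forall xi, measurable_fun setT (fun x => g x xi)) ->
    measurable_fun setT (fun x => g x (v x)) -> measurable_fun setT v ->
    {ae mu, forall x, forall t y z, 0 <= t <= 1 ->
      g x (t *: y + (1 - t) *: z) <= t * g x y + (1 - t) * g x z} ->
    {ae mu, forall x, forall y c, c < g x y -> \forall z \near y, c < g x z} ->
  exists (S : set X) (a : X -> R) (b : X -> borel V) (K : R),
    [/\ measurable S /\ S `<=` D, (mu (D `\` S) <= del%:E)%E,
        measurable_fun setT a /\ measurable_fun setT b,
        0 <= K /\ (forall x, `|a x| <= K /\ enorm (b x) <= K) &
        {ae mu, forall x, S x ->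
          (forall xi, a x + dotp (b x) xi - e * (1 + enorm xi) <= g x xi) /\
          g x (v x) - e * (2 + enorm (v x)) <= a x + dotp (b x) (v x)}].
Proof.
move=> mD Dfin e0 del0 mg mgv mv g_conv g_lsc.
pose cell (i : nat) : Q := odflt (0, 0) (unpickle i).
pose ca i : R := ratr (cell i).1.
pose cb i : V := map_mx ratr (cell i).2.
pose rxi (j : nat) : V := map_mx ratr (odflt 0 (unpickle j) : 'rV[rat]_d.+1).
(* Only rational [xi] are tested, which keeps the cell measurable. *)
pose A i : set X := (\bigcap_j [set x | ca i + dotp (cb i) (rxi j) -
    e * (1 + enorm (rxi j)) <= g x (rxi j)]) `&`
  [set x | g x (v x) - e * (2 + enorm (v x)) <= ca i + dotp (cb i) (v x)].
have mle (h k : X -> R) : measurable_fun setT h -> measurable_fun setT k ->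
    measurable [set x | h x <= k x].
  by move=> mh mk; rewrite -[X in measurable X]setTI; exact: measurable_fun_le.
have mA i : measurable (A i).
  apply: measurableI.
    by apply: bigcapT_measurable => j; apply: mle => //; exact: measurable_cst.
  apply: mle; first apply: measurable_funB => //; first apply: measurable_funM.
  - exact: measurable_cst.
  - by apply: measurable_funD; [exact: measurable_cst|exact: measurable_enorm].
  - apply: measurable_funD; first exact: measurable_cst.
    by apply: measurable_dotp => //; exact: measurable_cst.
have A_cover : {ae mu, forall x, exists i, A i x}.
  apply: filterS2 g_conv g_lsc => x gc gl.
  have [a [b [ab abv]]] := convex_rational_minorant gc gl (v x) e0.
  exists (pickle (a, b)); split=> [j _|] /=; rewrite /ca /cb /cell pickleK/=.
    exact: ab.
  exact: abv.
have [N hN] := measurable_finite_cover mD Dfin mA A_cover del0.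
have [s [ms sA sc]] := measurable_selection
  (fun i => (ca i, cb i) : (R * borel V)%type) N mA.
exists (D `&` \bigcup_(i < N) A i), (fun x => (s x).1), (fun x => (s x).2).
exists (\sum_(i < N.+1) (`|ca i| + enorm (cb i))); split.
- by split=> [|x []//]; apply: measurableI => //; exact: bigcup_measurable.
- by rewrite setDIr setDv set0U.
- split; first exact: measurableT_comp ms.
  exact: (measurableT_comp (f := snd)) ms.
- split=> [|x]; first by apply: sumr_ge0 => j _; rewrite addr_ge0 ?enorm_ge0.
  have [i iN ->] := sc x; rewrite /=.
  rewrite (bigD1 (Ordinal (iN : (i < N.+1)%N)))//=.
  have r0 : 0 <= \sum_(j < N.+1 | j != Ordinal (iN : (i < N.+1)%N))
      (`|ca j| + enorm (cb j)).
    by apply: sumr_ge0 => j _; rewrite addr_ge0 ?enorm_ge0.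
  have := normr_ge0 (ca i); have := enorm_ge0 (cb i); lra.
- apply: filterS2 g_conv g_lsc => x gc gl [_ /sA[i [_ [Ai Avi] ->]]] /=.
  split=> // xi.
  rewrite leNgt; apply/negP => lt_xi.
  (* [g x] is upper semicontinuous and [phi] continuous, so that a strict failure
     at [xi] would persist at a rational point. *)
  pose phi y := ca i + dotp (cb i) y - e * (1 + enorm y).
  have cphi : continuous phi.
    move=> y; apply: (@continuousB _ _ _ (fun y => ca i + dotp (cb i) y)
        (fun y => e * (1 + enorm y))).
      by apply: continuousD; [exact: cst_continuous|exact: continuous_dotpr].
    apply: continuousM; first exact: cst_continuous.
    by apply: continuousD; [exact: cst_continuous|exact: continuous_enorm].
  pose mid := (g x xi + phi xi) / 2.
  have lt_mid : g x xi < mid by rewrite /mid /phi; lra.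
  have mid_lt : mid < phi xi by rewrite /mid; move: lt_xi; rewrite -/(phi xi); lra.
  have /cvgr_gt/(_ _ mid_lt) phi_near : phi y @[y --> xi] --> phi xi by exact: cphi.
  have /nbhs_ballP[r /= r0 hr] : nbhs xi [set y | g x y < mid /\ mid < phi y].
    exact: filterI (convex_usc gc lt_mid) phi_near.
  have [q /ball_sym/hr[/= g_lt phi_gt]] := rV_rat_dense xi r0.
  have := Ai (pickle q) I; rewrite /= /rxi pickleK/= -/(phi _) leNgt => /negP; apply.
  exact: lt_trans phi_gt.
Qed.

End affine_selection.

(** * Lower semicontinuity under a uniformly integrable lower bound *)

Section lower_semicontinuity.
Context {R : realType} {d : nat} {dX : measure_display} {X : measurableType dX}.
Variable mu : {measure set X -> \bar R}.
Local Notation V := 'rV[R]_d.+1.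
Variables (p p' K c : R) (f : X -> R -> V -> R).
Variables (un : nat -> X -> R) (u : X -> R).
Variables (vn : nat -> X -> borel V) (v : X -> borel V).
Variables (G : nat -> X -> R) (H : X -> R).
Let fn n x := f x (un n x) (vn n x).
Let f0 x := f x (u x) (v x).
Hypotheses (p1 : 1 < p) (p'1 : 1 < p') (pp' : p^-1 + p'^-1 = 1).
Hypothesis mfn : forall n, measurable_fun setT (fn n).
Hypothesis mf0 : measurable_fun setT f0.
Hypothesis mfu : forall xi, measurable_fun setT (fun x => f x (u x) xi).
Hypothesis f_lsc : {ae mu, forall x, lower_semicontinuous
  (fun w : (R * V)%type => (f x w.1 w.2)%:E)}.
Hypothesis f_conv : {ae mu, forall x, forall z t y1 y2, 0 <= t <= 1 ->
  f x z (t *: y1 + (1 - t) *: y2) <= t * f x z y1 + (1 - t) * f x z y2}.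
Hypothesis un_u : {ae mu, forall x, un n x @[n --> \oo] --> u x}.
Hypothesis mvn : forall n, measurable_fun setT (vn n).
Hypothesis mv : measurable_fun setT v.
Hypothesis vn_bd : forall n, (\int[mu]_x (enorm (vn n x) `^ p)%:E <= K%:E)%E.
Hypothesis v_bd : (\int[mu]_x (enorm (v x) `^ p)%:E <= K%:E)%E.
Hypothesis vn_v : forall b : X -> borel V, measurable_fun setT b ->
  (\int[mu]_x (enorm (b x) `^ p')%:E < +oo)%E ->
  pairing mu b (vn n) @[n --> \oo] --> pairing mu b v.
Hypothesis pG : forall n, nneg_meas (G n).
Hypothesis uG : unif_integrable mu G.
Hypothesis fG : {ae mu, forall x, forall n, - G n x <= fn n x}.
Hypothesis pH : nneg_meas H.
Hypothesis Hfin : (\int[mu]_x (H x)%:E < +oo)%E.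
Hypothesis fH : {ae mu, forall x, - H x <= f0 x}.
Hypothesis fc : forall n, (\int[mu]_x (fn n x)%:E <= c%:E)%E.

Let p0 : 0 < p. Proof. exact: lt_trans p1. Qed.
Let p'0 : 0 < p'. Proof. exact: lt_trans p'1. Qed.

Let Lpvn n : Lpv mu p (vn n).
Proof. by split => //; apply: le_lt_trans (vn_bd n) _; rewrite ltry. Qed.

Let Lpv0 : Lpv mu p v.
Proof. by split => //; apply: le_lt_trans v_bd _; rewrite ltry. Qed.

Let nneg_meas_wt (D : set X) (k : R) (w : X -> borel V) : measurable D -> 0 <= k ->
  measurable_fun setT w -> nneg_meas (fun x => \1_D x * (k + enorm (w x))).
Proof.
move=> mD k0 mw; apply: nneg_measM; first exact: nneg_meas_indic.
split=> [|x]; last by rewrite addr_ge0 ?enorm_ge0.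
by apply: measurable_funD; [exact: measurable_cst|exact: measurable_enorm].
Qed.

Let K0 : 0 <= K.
Proof.
rewrite -lee_fin; apply: le_trans v_bd; apply: integral_ge0 => x _.
by rewrite lee_fin powR_ge0.
Qed.

Let weight_le (D : set X) (w : X -> borel V) : measurable D -> (mu D < +oo)%E ->
    measurable_fun setT w -> (\int[mu]_x (enorm (w x) `^ p)%:E <= K%:E)%E ->
  (\int[mu]_x (\1_D x * (2 + enorm (w x)))%:E <= (3 * fine (mu D) + K)%:E)%E.
Proof.
move=> mD Dfin mw wK; have pD : nneg_meas (\1_D : X -> R) by exact: nneg_meas_indic.
have pDw : nneg_meas (fun x => 3 * \1_D x) := nneg_measZ (ler0n _ 3) pD.
have pw := nneg_meas_enorm p mw.
apply: (@le_trans _ _ (\int[mu]_x (3 * \1_D x + enorm (w x) `^ p)%:E)%E).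
  apply: nneg_meas_le => //; [exact: nneg_meas_wt|exact: nneg_measD|move=> x _].
  have e0 := enorm_ge0 (w x).
  have : enorm (w x) <= 1 + enorm (w x) `^ p.
    have [e1|/ltW e1] := leP (enorm (w x)) 1.
      by apply: (le_trans e1); rewrite lerDl powR_ge0.
    rewrite -[leLHS]powRr1//; apply: (@le_trans _ _ (enorm (w x) `^ p)).
      by rewrite ler_powR// ltW.
    by rewrite lerDr.
  have := powR_ge0 (enorm (w x)) p.
  by rewrite indicE; case: (x \in D); rewrite ?mul1r ?mul0r ?mulr1 ?mulr0; lra.
rewrite nneg_meas_intD// nneg_meas_intZ// integral_indic// setIT.
rewrite (EFinD (3 * _)) (EFinM 3) fineK ?ge0_fin_numE//; exact: leeD.
Qed.

Let unif_weight (D : set X) : measurable D -> (mu D < +oo)%E ->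
  unif_integrable mu (fun n x => \1_D x * (1 + enorm (vn n x))).
Proof.
move=> mD Dfin; have pD : nneg_meas (\1_D : X -> R) by exact: nneg_meas_indic.
have Dint : (\int[mu]_x (\1_D x)%:E < +oo)%E by rewrite integral_indic// setIT.
have pvn n : nneg_meas (fun x => enorm (vn n x)).
  by split=> [|x]; [exact: measurable_enorm|exact: enorm_ge0].
apply: (@unif_integrable_le _ _ _ mu _ (fun n x => \1_D x + \1_D x * enorm (vn n x))).
- by move=> n; exact: nneg_meas_wt.
- by move=> n; apply: nneg_measD => //; exact: nneg_measM.
- by move=> n x; rewrite mulrDr mulr1.
apply: unif_integrableD => //; first by move=> n; exact: nneg_measM.
  exact: unif_integrable_cst.
apply: (@unif_integrableM _ _ _ mu p p' K) => //.
rewrite (_ : (fun _ _ => _) = fun=> (\1_D : X -> R)); first exact: unif_integrable_cst.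
apply/funext => n; apply/funext => x; rewrite indicE.
by case: (x \in D); rewrite ?powR1// powR0// gt_eqF.
Qed.

Let minorant_eventually (S : set X) (a : X -> R) (b : X -> borel V) (e M : R) : 0 < e ->
    {ae mu, forall x, S x -> forall xi,
      a x + dotp (b x) xi - e * (1 + enorm xi) <= f x (u x) xi} ->
  {ae mu, forall x, S x -> \forall n \near \oo, enorm (vn n x) <= M ->
    a x + dotp (b x) (vn n x) - e * (2 + enorm (vn n x)) <= fn n x}.
Proof.
move=> e0 a_minor; apply: filterS3 f_lsc un_u a_minor => x fl ux minor Sx.
have h := lsc_minorant_near M fl e0 (minor Sx).
have : \forall n \near \oo, forall xi, enorm xi <= M ->
    a x + dotp (b x) xi - e * (2 + enorm xi) <= f x (un n x) xi := ux _ h.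
by apply: filterS => n hn; exact: hn.
Qed.

(** The heart of the matter: cut off to a set [S] of finite measure on which
   [f x (u x) _] has bounded affine almost-minorants [a x + b x . xi]. There
   [v] enters linearly, so that the weak convergence of [vn] applies; the minorant
   bounds [fn n] except on the set [T n] where either [vn n] is large or [un n] is
   not yet close to [u], and there the loss is at most the integral of [G n]. *)
Let truncated_lsc (tau : X -> R) (eta : R) : nneg_meas tau ->
    (\int[mu]_x (tau x)%:E < +oo)%E ->
    {ae mu, forall x, tau x <= f0 x + H x} -> 0 < eta ->
  (\int[mu]_x (tau x)%:E <= c%:E + \int[mu]_x (H x)%:E + (5 * eta)%:E)%E.
Proof.
move=> ptau taufin tau_le eta0.
have ptH : nneg_meas (fun x => tau x + H x) by exact: nneg_measD.
(* Adding [tau + H] makes one set [D] serve both for the lower bounds [- G n] and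
   for the mass of [tau] outside [S]. *)
pose G' n x := G n x + (tau x + H x).
have pG' n : nneg_meas (G' n) by exact: nneg_measD.
have uG' : unif_integrable mu G'.
  apply: unif_integrableD => //; apply: unif_integrable_cst => //.
  by rewrite nneg_meas_intD// lte_add_pinfty.
have [D [del [mD Dfin del0 hG']]] := uG' _ eta0.
pose Ad := 3 * fine (mu D) + K.
have Ad0 : 0 <= Ad by rewrite addr_ge0// mulr_ge0// fine_ge0.
(* [Ad] bounds the integral of [2 + enorm w] over [D] for all the fields [w] at
   hand, so that the linear error of the minorants costs at most [eta]. *)
pose e := eta / (Ad + 1); have e0 : 0 < e by rewrite divr_gt0// ltr_wpDl.
have eAd : e * Ad <= eta.
  by rewrite /e mulrAC ler_pdivrMr ?ltr_wpDl// ler_pM2l// lerDl.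
have intD (w : X -> borel V) : measurable_fun setT w ->
    (\int[mu]_x (enorm (w x) `^ p)%:E <= K%:E)%E ->
    (\int[mu]_x (e * (\1_D x * (2 + enorm (w x))))%:E <= eta%:E)%E.
  move=> mw wK; rewrite nneg_meas_intZ ?(ltW e0)//; last exact: nneg_meas_wt.
  apply: (@le_trans _ _ (e%:E * Ad%:E)%E); last by rewrite -EFinM lee_fin.
  by apply: lee_wpmul2l; [rewrite lee_fin ltW|exact: weight_le].
have [S [a [b [K1 [[mS DS] SD [ma mb] [K10 abK] sel]]]]] :
  exists (S : set X) (a : X -> R) (b : X -> borel V) (K1 : R),
    [/\ measurable S /\ S `<=` D, (mu (D `\` S) <= (del / 3)%:E)%E,
        measurable_fun setT a /\ measurable_fun setT b,
        0 <= K1 /\ (forall x, `|a x| <= K1 /\ enorm (b x) <= K1) &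
        {ae mu, forall x, S x ->
          (forall xi, a x + dotp (b x) xi - e * (1 + enorm xi) <= f x (u x) xi) /\
          f0 x - e * (2 + enorm (v x)) <= a x + dotp (b x) (v x)}].
  apply: affine_selection => //; first by rewrite divr_gt0.
    by apply: filterS f_conv => x h t y z t01; exact: h.
  apply: filterS f_lsc => x h y k; rewrite -lte_fin => /(h (u x, y) k)[W W0 hW].
  case: W0 => -[A B] /= [Aux By] AB; apply: filterS By => z Bz.
  have := hW (u x, z); rewrite /= lte_fin; apply; apply: (AB (u x, z)); split => //=.
  exact: nbhs_singleton.
(* [Wn] dominates the affine minorant; the bound [K1] being known only now, a
   second uniform integrability threshold [del2] is needed. *)
pose Wn n x := K1 * (\1_D x * (1 + enorm (vn n x))).
have pWn n : nneg_meas (Wn n) by apply: nneg_measZ => //; exact: nneg_meas_wt.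
have uW : unif_integrable mu Wn.
  by apply: unif_integrableZ => //; [move=> n; exact: nneg_meas_wt|exact: unif_weight].
have [D2 [del2 [mD2 _ del20 hW]]] := uW _ eta0.
pose del' := Num.min (del / 3) (del2 / 2).
have del'0 : 0 < del' by rewrite lt_min !divr_gt0.
have del'_le : del / 3 + (del' + del') <= del.
  have : del' <= del / 3 by rewrite ge_min lexx.
  by lra.
have del'_le2 : del' + del' <= del2.
  have : del' <= del2 / 2 by rewrite ge_min lexx orbT.
  by lra.
(* Markov's inequality: [mu (An n) <= Ad / M <= del']. *)
pose M := Ad / del' + 1.
have M0 : 0 < M by rewrite ltr_wpDl// divr_ge0// ltW.
pose An n := D `&` [set x | M < enorm (vn n x)].
pose Zn n := S `&` [set x | enorm (vn n x) <= M] `&`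
  [set x | fn n x < a x + dotp (b x) (vn n x) - e * (2 + enorm (vn n x))].
have mle (h k : X -> R) : measurable_fun setT h -> measurable_fun setT k ->
    measurable [set x | h x <= k x].
  by move=> mh mk; rewrite -[X in measurable X]setTI; exact: measurable_fun_le.
have mlt (h k : X -> R) : measurable_fun setT h -> measurable_fun setT k ->
    measurable [set x | h x < k x].
  move=> mh mk; rewrite (_ : [set x | _] = ~` [set x | k x <= h x]).
    by apply: measurableC; exact: mle.
  by apply/seteqP; split=> x /=; rewrite ltNge => /negP.
have men n : measurable_fun setT (fun x => enorm (vn n x)) by exact: measurable_enorm.
have mAn n : measurable (An n).
  by apply: measurableI => //; apply: mlt => //; exact: measurable_cst.
have mZn n : measurable (Zn n).
  apply: measurableI; first apply: measurableI => //.
    by apply: mle => //; exact: measurable_cst.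
  apply: mlt => //; apply: measurable_funB.
    by apply: measurable_funD => //; exact: measurable_dotp.
  apply: measurable_funM; first exact: measurable_cst.
  by apply: measurable_funD => //; exact: measurable_cst.
have muAn n : (mu (An n) <= del'%:E)%E.
  have h : (M%:E * mu (An n) <= Ad%:E)%E.
    apply: le_trans (weight_le mD Dfin (mvn n) (vn_bd n)).
    have pAn : nneg_meas (fun x => M * \1_(An n) x).
      exact: (nneg_measZ (ltW M0) (nneg_meas_indic (mAn n))).
    rewrite -[X in (_ * mu X)%E]setIT -integral_indic//.
    rewrite -(nneg_meas_intZ mu measurableT (ltW M0) (nneg_meas_indic (mAn n))).
    apply: nneg_meas_le => //; first exact: nneg_meas_wt.
    move=> x _; have e1 := enorm_ge0 (vn n x).
    have w0 : 0 <= \1_D x * (2 + enorm (vn n x)).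
      by rewrite mulr_ge0// addr_ge0.
    rewrite [in leLHS]indicE; case: (boolP (x \in An n)) => [|_]; last by rewrite mulr0.
    rewrite inE => -[Dx /= /ltW Mx]; rewrite mulr1 indicE mem_set// mul1r.
    by apply: le_trans Mx _; rewrite lerDr.
  have Afin : mu (An n) \is a fin_num.
    rewrite ge0_fin_numE//; apply: le_lt_trans Dfin.
    by apply: le_measure; rewrite ?inE//; move=> x [].
  move: h; rewrite -(fineK Afin) -EFinM !lee_fin => h.
  have : M * fine (mu (An n)) <= M * del'.
    by apply: le_trans h _; rewrite /M mulrDl divfK ?gt_eqF// mul1r lerDl ltW.
  by rewrite ler_pM2l.
have Z_ev : {ae mu, forall x, \forall n \near \oo, ~ Zn n x}.
  have minor : {ae mu, forall x, S x -> forall xi,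
      a x + dotp (b x) xi - e * (1 + enorm xi) <= f x (u x) xi}.
    by apply: filterS sel => x h Sx; have [] := h Sx.
  apply: filterS (minorant_eventually M e0 minor) => x hx.
  have [Sx|nSx] := pselect (S x); last by apply: nearW => n [[Sx _] _].
  apply: filterS (hx Sx) => n hn [[_ /= xM]] /=; rewrite ltNge => /negP; apply.
  exact: hn.
have Sfin : (mu S < +oo)%E.
  by apply: le_lt_trans Dfin; apply: le_measure; rewrite ?inE.
have muZn : \forall n \near \oo, (mu (Zn n) <= del'%:E)%E.
  by apply: (mu_eventually_avoided mS Sfin) => // n x [[]].
pose T' n := An n `|` Zn n.
pose T n := ~` S `|` T' n.
have mT' n : measurable (T' n) by exact: measurableU.
have mT n : measurable (T n) by apply: measurableU => //; exact: measurableC.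
pose aS x := \1_S x * a x.
pose bS : X -> borel V := fun x => \1_S x *: (b x : V).
pose psi w x := aS x + dotp (bS x) (w x : V).
(* [Pn] is the total loss: on [T n] the lower bound [- G n] and, on [T' n], the
   minorant itself; elsewhere the linear error. *)
pose Pn n x := \1_(T n) x * G' n x + (\1_(T' n) x * Wn n x +
  e * (\1_D x * (2 + enorm (vn n x)))).
have pP1 n : nneg_meas (fun x => \1_(T n) x * G' n x).
  by apply: nneg_measM => //; exact: nneg_meas_indic.
have pP2 n : nneg_meas (fun x => \1_(T' n) x * Wn n x).
  by apply: nneg_measM => //; exact: nneg_meas_indic.
have pP3 (w : X -> borel V) : measurable_fun setT w ->
    nneg_meas (fun x => e * (\1_D x * (2 + enorm (w x)))).
  by move=> mw; apply: nneg_measZ; [exact: ltW|exact: nneg_meas_wt].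
have pPn n : nneg_meas (Pn n).
  by apply: nneg_measD => //; apply: nneg_measD => //; exact: pP3.
have muT' n : (mu (Zn n) <= del'%:E)%E -> (mu (T' n) <= (del' + del')%:E)%E.
  move=> hZ; apply: le_trans (measureU2 _ _ _) _ => //.
  by rewrite EFinD; exact: leeD (muAn n) hZ.
have Pn_le : \forall n \near \oo, (\int[mu]_x (Pn n x)%:E <= (3 * eta)%:E)%E.
  apply: filterS3 hG' hW muZn => n hG hWn /muT' hT'.
  rewrite (nneg_meas_intD mu measurableT (pP1 n) (nneg_measD (pP2 n) (pP3 _ (mvn n)))).
  rewrite (nneg_meas_intD mu measurableT (pP2 n) (pP3 _ (mvn n))).
  rewrite !nneg_meas_int_indic//.
  rewrite (_ : 3 * eta = eta + (eta + eta)); last by ring.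
  rewrite (EFinD eta) (EFinD eta); apply: leeD; last apply: leeD.
  - apply: hG => //; apply: (@le_trans _ _ (mu ((D `\` S) `|` T' n))).
      apply: le_measure; rewrite ?inE.
      + exact: measurableI.
      + by apply: measurableU => //; exact: measurableD.
      + by move=> x [[nSx|T'x] Dx]; [left|right].
    apply: le_trans (measureU2 _ _ _) _ => //; first exact: measurableD.
    apply: (@le_trans _ _ ((del / 3)%:E + (del' + del')%:E)%E); first exact: leeD.
    by rewrite -EFinD lee_fin.
  - apply: hWn => //; apply: (@le_trans _ _ (mu (T' n))).
      apply: le_measure; rewrite ?inE//; first exact: measurableI.
    by apply: le_trans hT' _; rewrite lee_fin.
  - exact: (intD (vn n) (mvn n) (vn_bd n)).
have mnS : measurable (~` S) by exact: measurableC.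
have tail_le : (\int[mu]_(x in ~` S) (tau x + H x)%:E <= eta%:E)%E.
  have SD' : (mu (~` S `&` D) <= del%:E)%E.
    rewrite setIC -setDE. apply: le_trans SD _.
    rewrite lee_fin ler_pdivrMr// ler_peMr ?(ltW del0)//.
    by rewrite ler1n.
  case: hG' => n _ /(_ n (leqnn n) _ mnS SD'); apply: le_trans.
  apply: nneg_meas_le => // x _.
  by rewrite /G' lerDr; exact: (pG n).2.
clear hG' hW.
have psi_le : {ae mu, forall x, forall n, psi (vn n) x - Pn n x <= fn n x}.
  apply: filterS fG => x fGx n; rewrite lerBlDr.
  have fG'x : 0 <= fn n x + G' n x.
    by move: (fGx n) (ptH.2 x); rewrite /G' /=; lra.
  have w1 := (pP1 n).2 x; have w2 := (pP2 n).2 x; have w3 := (pP3 _ (mvn n)).2 x.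
  have e1 := enorm_ge0 (vn n x).
  rewrite /psi /aS /bS dotpZl -mulrDr.
  have [Sx|nSx] := pselect (S x); last first.
    rewrite indicE memNset// mul0r addrA; apply: addr_ge0; last exact: addr_ge0.
    by rewrite indicE mem_set ?mul1r//; left.
  rewrite indicE mem_set// mul1r; have Dx := DS _ Sx.
  have [T'x|nT'x] := pselect (T' n x).
    have TE : \1_(T n) x = 1 :> R by rewrite indicE mem_set//; right.
    have T'E : \1_(T' n) x = 1 :> R by rewrite indicE mem_set.
    have DE : \1_D x = 1 :> R by rewrite indicE mem_set.
    rewrite /Pn TE T'E !mul1r /Wn DE !mul1r.
    have [ha hb] := abK x.
    have : dotp (b x) (vn n x) <= K1 * enorm (vn n x).
      apply: le_trans (ler_norm _) _; apply: le_trans (cauchy_schwarz _ _) _.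
      exact: ler_wpM2r.
    move: (ler_norm (a x)) w3 ha hb fG'x; rewrite DE mul1r; lra.
  have xM : enorm (vn n x) <= M.
    by rewrite leNgt; apply/negP => h; apply: nT'x; left.
  have : a x + dotp (b x) (vn n x) - e * (2 + enorm (vn n x)) <= fn n x.
    by rewrite leNgt; apply/negP => h; apply: nT'x; right; split => //; split.
  have DE : \1_D x = 1 :> R by rewrite indicE mem_set.
  by move: w1 w2; rewrite /Pn DE mul1r; lra.
have mbS : measurable_fun setT bS.
  apply: measurable_fun_rV; [exact: measurableT|move=> i].
  under eq_fun do rewrite mxE.
  apply: measurable_funM; first exact: measurable_indic.
  exact: (measurableT_comp (measurable_fun_coord i) mb).
have maS : measurable_fun setT aS.
  by apply: measurable_funM => //; exact: measurable_indic.
have pS : nneg_meas (\1_S : X -> R) by exact: nneg_meas_indic.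
have bSfin : (\int[mu]_x (enorm (bS x) `^ p')%:E < +oo)%E.
  apply: (@le_lt_trans _ _ (\int[mu]_x (K1 `^ p' * \1_S x)%:E)%E).
    apply: nneg_meas_le => //; first exact: nneg_meas_enorm.
      exact: (nneg_measZ (powR_ge0 _ _) pS).
    move=> x _; rewrite /bS enormZ indicE; case: (x \in S).
      rewrite normr1 mul1r mulr1.
      apply: ge0_ler_powR; rewrite ?nnegrE ?enorm_ge0 ?(ltW p'0)//.
      exact: (abK x).2.
    by rewrite normr0 mul0r mulr0 powR0// gt_eqF.
  rewrite (nneg_meas_intZ mu measurableT (powR_ge0 _ _) pS) integral_indic// setIT.
  by rewrite lte_mul_pinfty// lee_fin powR_ge0.
have iaS : mu.-integrable setT (EFin \o aS).
  apply: (@le_integrable _ X R mu setT measurableT _ (EFin \o (fun x => K1 * \1_S x))).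
  - exact/measurable_EFinP.
  - move=> x _; rewrite /= lee_fin /aS normrM mulrC.
    rewrite [leRHS]normrM (ger0_norm K10) ler_wpM2r//.
    exact: (abK x).1.
  - apply: nneg_meas_integrable; first exact: nneg_measZ.
    rewrite (nneg_meas_intZ mu measurableT K10 pS) integral_indic// setIT.
    by rewrite lte_mul_pinfty// lee_fin.
have ipair w : Lpv mu p w -> mu.-integrable setT (fun x => (dotp (bS x) (w x : V))%:E).
  by move=> Lw; exact: (pairing_integrable p0 p'0 pp' mbS bSfin Lw).
have ipsi w : Lpv mu p w -> mu.-integrable setT (EFin \o psi w).
  by move=> Lw; exact: (integrableD measurableT iaS (ipair _ Lw)).
pose ia := \int[mu]_x aS x.
have int_psi w : Lpv mu p w -> (\int[mu]_x (psi w x)%:E = (ia + pairing mu bS w)%:E)%E.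
  move=> Lw; rewrite EFinD /ia /pairing /Rintegral !fineK//.
  - by rewrite -integralD//; exact: ipair.
  - exact: integrable_fin_num (ipair _ Lw).
  - exact: integrable_fin_num iaS.
have psi_c : \forall n \near \oo, ia + pairing mu bS (vn n) <= c + 3 * eta.
  apply: filterS Pn_le => n hP.
  have iP : mu.-integrable setT (EFin \o Pn n).
    by apply: nneg_meas_integrable => //; apply: le_lt_trans hP _; rewrite ltry.
  have : (\int[mu]_x (psi (vn n) x - Pn n x)%:E <= c%:E)%E.
    apply: le_trans (fc n); apply: integrable_ae_le_integral => //.
      exact: (integrableB measurableT (ipsi _ (Lpvn n)) iP).
    by apply: filterS psi_le => x h _; exact: h.
  have -> := integralB_EFin measurableT (ipsi _ (Lpvn n)) iP.
  have -> := int_psi _ (Lpvn n).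
  rewrite leeBlDr ?(integrable_fin_num measurableT iP)// => h.
  by rewrite -lee_fin (EFinD c); apply: le_trans h _; rewrite leeD2l.
have psi0_c : ia + pairing mu bS v <= c + 3 * eta.
  rewrite leNgt; apply/negP; rewrite -ltrBlDl => lt.
  have gt_near := cvgr_gt _ (vn_v mbS bSfin) _ lt.
  have [n _ /(_ n (leqnn n))[]] := filterI psi_c (gt_near _).
  by rewrite -lerBrDl leNgt => /negP h1 /h1.
pose Qn x := H x + (\1_(~` S) x * (tau x + H x) + e * (\1_D x * (2 + enorm (v x)))).
have pQ1 : nneg_meas (fun x => \1_(~` S) x * (tau x + H x)).
  by apply: nneg_measM => //; exact: nneg_meas_indic.
have pQ : nneg_meas Qn.
  by apply: nneg_measD => //; apply: nneg_measD => //; exact: pP3.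
have Q_le : (\int[mu]_x (Qn x)%:E <= \int[mu]_x (H x)%:E + (2 * eta)%:E)%E.
  rewrite (nneg_meas_intD mu measurableT pH (nneg_measD pQ1 (pP3 _ mv))).
  rewrite leeD2l// (nneg_meas_intD mu measurableT pQ1 (pP3 _ mv)).
  rewrite (_ : 2 * eta = eta + eta); last by ring.
  rewrite (EFinD eta); apply: leeD; last exact: (intD v mv v_bd).
  by rewrite nneg_meas_int_indic.
have iQ : mu.-integrable setT (EFin \o Qn).
  apply: nneg_meas_integrable => //; apply: le_lt_trans Q_le _.
  by rewrite lte_add_pinfty// ltry.
have tau_psi : {ae mu, forall x, tau x <= psi v x + Qn x}.
  apply: filterS2 tau_le sel => x tx selx.
  have e1 := enorm_ge0 (v x); have t0 := ptau.2 x; have H0 := pH.2 x.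
  have w1 := pQ1.2 x; have w3 := (pP3 _ mv).2 x.
  rewrite /psi /aS /bS dotpZl -mulrDr.
  have [Sx|nSx] := pselect (S x); last first.
    have E1 : \1_(~` S) x = 1 :> R by rewrite indicE mem_set.
    have E2 : \1_S x = 0 :> R by rewrite indicE memNset.
    rewrite /Qn E1 E2 mul1r mul0r add0r.
    by move: w3 H0 t0; lra.
  have [_ h] := selx Sx; have Dx := DS _ Sx.
  have SE : \1_S x = 1 :> R by rewrite indicE mem_set.
  have DE : \1_D x = 1 :> R by rewrite indicE mem_set.
  rewrite SE mul1r /Qn DE mul1r.
  by move: tx h w1 t0 H0 e1; lra.
apply: (@le_trans _ _ (\int[mu]_x (psi v x + Qn x)%:E)%E).
  apply: integrable_ae_le_integral => //.
  - exact: nneg_meas_integrable.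
  - apply: measurable_funD; last exact: pQ.1.
    by apply: measurable_funD => //; exact: measurable_dotp.
  - by apply: filterS tau_psi => x h _.
have -> := integralD_EFin measurableT (ipsi _ Lpv0) iQ.
have -> := int_psi _ Lpv0.
apply: (@le_trans _ _ ((c + 3 * eta)%:E + (\int[mu]_x (H x)%:E + (2 * eta)%:E))%E).
  by apply: leeD.
have Hf : (\int[mu]_x (H x)%:E)%E \is a fin_num.
  by rewrite ge0_fin_numE//; apply: integral_ge0 => x _; rewrite lee_fin pH.2.
by rewrite -(fineK Hf) -!EFinD lee_fin; lra.
Qed.

(** [f0 + H] is nonnegative, and the increasing limit of truncations of finite
   integral, to each of which the previous bound applies with [eta] tending to 0. *)
Lemma integral_lsc_le (B : nat -> set X) : (forall k, measurable (B k)) ->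
    (forall k, (mu (B k) < +oo)%E) -> nondecreasing_seq B ->
    (forall x, exists k, B k x) ->
  (\int[mu]_x (f0 x)%:E <= c%:E)%E.
Proof.
move=> mB Bfin ndB Bcover.
pose w x := Num.max 0 (f0 x + H x).
have pw : nneg_meas w.
  split=> [|x]; last by rewrite le_max lexx.
  apply: measurable_maxr; first exact: measurable_cst.
  by apply: measurable_funD => //; exact: pH.1.
pose tau (k : nat) x := \1_(B k) x * Num.min (w x) k%:R.
have ptau k : nneg_meas (tau k).
  apply: nneg_measM; first exact: nneg_meas_indic.
  split=> [|x]; last by rewrite le_min pw.2/=.
  by apply: measurable_minr; [exact: pw.1|exact: measurable_cst].
have wE : {ae mu, forall x, w x = f0 x + H x}.
  by apply: filterS fH => x hx; rewrite /w max_r//; lra.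
have tau_w k x : tau k x <= w x.
  apply: (@le_trans _ _ (Num.min (w x) k%:R)); last by rewrite ge_min lexx.
  by rewrite ler_piMl// ?le_min ?pw.2//= indicE lern1 leq_b1.
have taufin k : (\int[mu]_x (tau k x)%:E < +oo)%E.
  have pBk : nneg_meas (\1_(B k) : X -> R) by exact: nneg_meas_indic.
  apply: (@le_lt_trans _ _ (\int[mu]_x (k%:R * \1_(B k) x)%:E)%E).
    apply: nneg_meas_le => //; first exact: (nneg_measZ (ler0n _ k) pBk).
    move=> x _; rewrite /tau mulrC; apply: ler_wpM2r; first exact: pBk.2.
    by rewrite ge_min lexx orbT.
  rewrite (nneg_meas_intZ mu measurableT (ler0n _ k) pBk) integral_indic// setIT.
  by rewrite lte_mul_pinfty// lee_fin.
pose L := (c%:E + \int[mu]_x (H x)%:E)%E.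
have tau_le k : (\int[mu]_x (tau k x)%:E <= L)%E.
  apply/lee_addgt0Pr => e e0; have e50 : 0 < e / 5 by rewrite divr_gt0.
  have := truncated_lsc (ptau k) (taufin k) _ e50.
  rewrite (_ : 5 * (e / 5) = e); last by rewrite mulrC divfK.
  by apply; apply: filterS wE => x <-.
have nd_tau m n x : (m <= n)%N -> tau m x <= tau n x.
  move=> mn; rewrite /tau; apply: ler_pM => //.
  - by rewrite le_min pw.2/=.
  - rewrite !indicE ler_nat; case: (boolP (x \in B m)) => // /set_mem Bmx.
    by rewrite mem_set//; have /subsetPset h := ndB _ _ mn; exact: h.
  - by rewrite le_min ge_min lexx/= ge_min ler_nat mn orbT.
have w_le : (\int[mu]_x (w x)%:E <= L)%E.
  have w_lim x : (w x)%:E = limn (fun k => (tau k x)%:E).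
    apply/esym/cvg_lim => //; apply: cvg_near_cst.
    have [k Bkx] := Bcover x.
    exists (maxn k (Num.truncn (w x)).+1) => // n /=; rewrite geq_max => /andP[kn wn].
    have Bnx : B n x by have /subsetPset h := ndB _ _ kn; exact: h.
    rewrite /tau indicE mem_set// mul1r min_l//.
    by apply: le_trans (ltW (truncnS_gt _)) _; rewrite ler_nat.
  under eq_integral do rewrite w_lim.
  rewrite monotone_convergence//.
  - apply: lime_le; last by apply: nearW => k; exact: tau_le.
    apply: ereal_nondecreasing_is_cvgn => m n mn.
    by apply: nneg_meas_le => // x _; exact: nd_tau.
  - by move=> k; exact: nneg_meas_fun.
  - by move=> k x _; rewrite lee_fin (ptau k).2.
  - by move=> x _ m n mn; rewrite lee_fin; exact: nd_tau.
have wfin : (\int[mu]_x (w x)%:E < +oo)%E.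
  by apply: le_lt_trans w_le _; rewrite lte_add_pinfty// ltry.
have iw := nneg_meas_integrable pw wfin.
have iH := nneg_meas_integrable pH Hfin.
have -> : (\int[mu]_x (f0 x)%:E = \int[mu]_x ((w x)%:E - (H x)%:E))%E.
  apply: ae_eq_integral => //.
  - exact/measurable_EFinP.
  - by apply: emeasurable_funB; apply: measurable_int; [exact: iw|exact: iH].
  - by apply: filterS wE => x -> _; rewrite -EFinB addrK.
have -> := integralB_EFin measurableT iw iH.
rewrite leeBlDr; first exact: w_le.
exact: (integrable_fin_num measurableT iH).
Qed.

End lower_semicontinuity.

(** * Convergences and subsequences *)

Section extraction.
Context {R : realType}.

Lemma ereal_between (x y : \bar R) : (x < y)%E ->
  exists c : R, (x < c%:E)%E /\ (c%:E < y)%E.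
Proof.
case: x y => [x| |] [y| |] //=; rewrite ?ltNyr ?ltry ?lte_fin => xy.
- by exists ((x + y) / 2); rewrite !lte_fin; split; lra.
- by exists (x + 1); rewrite lte_fin ltry; split=> //; lra.
- by exists (y - 1); rewrite lte_fin ltNyr; split=> //; lra.
- by exists 0; rewrite ltNyr ltry.
Qed.

Lemma limn_einf_frequently (F : nat -> \bar R) (c : R) (n : nat) :
  (limn_einf F < c%:E)%E -> exists2 k, (n <= k)%N & (F k <= c%:E)%E.
Proof.
rewrite limn_einf_lim => /(le_lt_trans _) lt.
have /lt : (einfs F n <= limn (einfs F))%E.
  rewrite (cvg_lim _ (cvg_einfs_sup (u := F)))//.
  by apply: ereal_sup_ubound; exists n.
by move=> /ereal_inf_lt[_ [k /= nk <-] /ltW Fk]; exists k.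
Qed.

Lemma cvg_subsequence (T : Type) (F : set_system T) (s : nat -> T) (phi : nat -> nat) :
  (forall m, (m <= phi m)%N) -> s n @[n --> \oo] --> F -> s (phi m) @[m --> \oo] --> F.
Proof.
move=> hphi sF A /sF[N _ hN]; exists N => // m /= Nm; apply: hN => /=.
exact: leq_trans (hphi m).
Qed.

Lemma powR_cvg0 (q : R) (x : nat -> R) : 0 < q ->
  `|x n| `^ q @[n --> \oo] --> 0 -> x n @[n --> \oo] --> 0.
Proof.
move=> q0 xq0; apply/cvgr0Pnorm_lt => e e0.
have eq0 : 0 < e `^ q by exact: powR_gt0.
move/cvgr0Pnorm_lt : xq0 => /(_ _ eq0); apply: filterS => n.
rewrite ger0_norm ?powR_ge0// => h; rewrite ltNge; apply/negP => ex.
move: h; rewrite ltNge => /negP; apply.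
by apply: ge0_ler_powR; rewrite ?nnegrE ?(ltW q0) ?(ltW e0).
Qed.

Lemma powRD_le (q a b : R) : 0 <= q -> 0 <= a -> 0 <= b ->
  (a + b) `^ q <= 2 `^ q * (a `^ q + b `^ q).
Proof.
move=> q0 a0 b0; apply: (@le_trans _ _ ((2 * Num.max a b) `^ q)).
  apply: ge0_ler_powR; rewrite ?nnegrE ?addr_ge0 ?mulr_ge0 ?le_max ?a0//.
  have : a <= Num.max a b by rewrite le_max lexx.
  have : b <= Num.max a b by rewrite le_max lexx orbT.
  by lra.
rewrite powRM// ?le_max ?a0// ler_wpM2l ?powR_ge0//.
by have [_|_] := leP a b; rewrite ?lerDl ?lerDr powR_ge0.
Qed.

End extraction.

Section convergences.
Context {R : realType} {d : nat} {dX : measure_display} {X : measurableType dX}.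
Variable mu : {measure set X -> \bar R}.
Local Notation V := 'rV[R]_d.+1.

(** [Lq_strong_cvg] and [Lp_weak_cvg] over an arbitrary measure. *)
Definition Lq_cvg (q : R) (un : nat -> X -> R) (u : X -> R) : Prop :=
  [/\ forall n, un n \in Lfun mu q%:E,
      u \in Lfun mu q%:E &
      (Lnorm mu q%:E (EFin \o (un n \- u)%R))%E @[n --> \oo] --> 0%E].

Definition Lpv_weak_cvg (p : R) (vn : nat -> X -> borel V) (v : X -> borel V) : Prop :=
  [/\ forall n, Lpv mu p (vn n), Lpv mu p v &
      forall L, bounded_linear mu p L -> L (vn n) @[n --> \oo] --> L v].

Lemma Lnorm_powR (q : R) (u : X -> R) : q != 0 ->
  (Lnorm mu q%:E (EFin \o u) `^ q = \int[mu]_x (`|u x| `^ q)%:E)%E.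
Proof. by move=> q0; rewrite poweR_Lnorm. Qed.

Lemma Lfun_int (q : R) (u : X -> R) : 0 < q -> u \in Lfun mu q%:E ->
  measurable_fun setT u /\ (\int[mu]_x (`|u x| `^ q)%:E < +oo)%E.
Proof.
move=> q0 /andP[/[!inE]/= mu_ ufin]; split; first exact: mu_.
by rewrite -Lnorm_powR ?gt_eqF//; exact: poweR_lty.
Qed.

Lemma Lq_cvg_int (q e : R) un u : 0 < q -> Lq_cvg q un u -> 0 < e ->
  \forall n \near \oo, (\int[mu]_x (`|un n x - u x| `^ q)%:E <= e%:E)%E.
Proof.
move=> q0 [_ _ un0] e0.
have lt : (0 < (e `^ q^-1)%:E)%E by rewrite lte_fin powR_gt0.
apply: filterS (cvge_lt_near un0 lt) => n /ltW h.
have <- := @Lnorm_powR q (fun x => un n x - u x) (lt0r_neq0 q0).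
have -> : (e%:E = (e `^ q^-1)%:E `^ q)%E.
  by rewrite poweR_EFin -powRrM mulVf ?gt_eqF// powRr1// ltW.
apply: gt0_ler_poweR h; first exact: ltW.
  by rewrite in_itv/= leey andbT Lnorm_ge0.
by rewrite in_itv/= leey andbT lee_fin powR_ge0.
Qed.

Lemma Lq_cvg_subsequence q un u (phi : nat -> nat) : (forall m, (m <= phi m)%N) ->
  Lq_cvg q un u -> Lq_cvg q (un \o phi) u.
Proof.
move=> hphi [Lun Lu cvg]; split => //; first by move=> n; exact: Lun.
exact: (cvg_subsequence hphi cvg).
Qed.

Lemma Lpv_weak_cvg_subsequence p vn v (phi : nat -> nat) : (forall m, (m <= phi m)%N) ->
  Lpv_weak_cvg p vn v -> Lpv_weak_cvg p (vn \o phi) v.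
Proof.
move=> hphi [Lvn Lv cvg]; split=> [n||L Ldual].
- exact: Lvn.
- exact: Lv.
- exact: (cvg_subsequence hphi (cvg L Ldual)).
Qed.

Lemma Lpv_weak_cvg_bounded p vn v : 1 < p -> Lpv_weak_cvg p vn v ->
  exists K : R, (forall n, \int[mu]_x (enorm (vn n x) `^ p)%:E <= K%:E)%E /\
    (\int[mu]_x (enorm (v x) `^ p)%:E <= K%:E)%E.
Proof.
move=> p1 [Lvn Lv cvg]; have p0 : 0 < p by exact: lt_trans p1.
have [|K hK] := pointwise_bounded_norm_bounded p1 Lvn.
  move=> L /cvg Lcvg; have /cvg_seq_bounded : cvgn (fun n => L (vn n)).
    by apply/cvg_ex; exists (L v).
  move=> [M [_ /(_ (M + 1))]]; rewrite ltrDl ltr01 => /(_ isT) h.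
  by exists (M + 1) => n; exact: h.
exists (K `^ p + Lpv_norm mu p v `^ p); split=> [n|].
  rewrite (Lpv_norm_integral (lt0r_neq0 p0) (Lvn n)) lee_fin.
  apply: (@le_trans _ _ (K `^ p)).
    have h0 := Lpv_norm_ge0 mu p (vn n).
    apply: ge0_ler_powR; rewrite ?nnegrE ?(ltW p0)//.
    exact: le_trans h0 (hK n).
  by rewrite lerDl powR_ge0.
by rewrite (Lpv_norm_integral (lt0r_neq0 p0) Lv) lee_fin lerDr powR_ge0.
Qed.

End convergences.

(** * The functional on a general measure space *)

Section main_inequality.
Context {R : realType} {d : nat} {dX : measure_display} {X : measurableType dX}.
Variable mu : {measure set X -> \bar R}.
Local Notation V := 'rV[R]_d.+1.
Variables (p q C1 C2 : R) (f : X -> R -> V -> R) (omega alpha : X -> R).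
Variables (beta : X -> R -> V) (B : set X) (D : nat -> set X).
Hypotheses (p1 : 1 < p) (q1 : 1 < q) (C10 : 0 < C1) (C20 : 0 < C2).
Hypothesis mf : forall (u : X -> R) (v : X -> borel V), measurable_fun setT u ->
  measurable_fun setT v -> measurable_fun setT (fun x => f x (u x) (v x)).
Hypothesis mbeta : forall u : X -> R, measurable_fun setT u ->
  measurable_fun setT ((fun x => beta x (u x)) : X -> borel V).
Hypothesis iomega : mu.-integrable setT (EFin \o omega).
Hypothesis ialpha : mu.-integrable setT (EFin \o alpha).
Hypothesis f_growth : {ae mu, forall x, forall z xi,
  - C1 * (`|z| `^ q + enorm xi `^ p) - omega x <= f x z xi}.
Hypothesis f_lsc : {ae mu, forall x, lower_semicontinuous
  (fun w : (R * V)%type => (f x w.1 w.2)%:E)}.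
Hypothesis f_conv : {ae mu, forall x, forall z t y1 y2, 0 <= t <= 1 ->
  f x z (t *: y1 + (1 - t) *: y2) <= t * f x z y1 + (1 - t) * f x z y2}.
Hypothesis f_affine : {ae mu, forall x, forall z xi,
  alpha x - C2 * `|z| `^ q + dotp (beta x z) xi <= f x z xi}.
Hypotheses (mB : measurable B) (Bfin : (mu B < +oo)%E).
Hypothesis beta_out : forall x z, ~ B x -> beta x z = beta x 0.
Hypothesis beta_out_fin :
  (\int[mu]_(x in ~` B) (enorm (beta x 0) `^ (p / (p - 1)))%:E < +oo)%E.
Hypothesis beta_equi : forall un u vn v, Lq_cvg mu q un u -> Lpv_weak_cvg mu p vn v ->
  (ereal_sup (range (fun n => \int[mu]_(x in B) (f x (un n x) (vn n x))%:E)) < +oo)%E ->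
  forall e : R, 0 < e -> exists2 delta : R, 0 < delta &
    forall E : set X, measurable E -> E `<=` B -> (mu E <= delta%:E)%E ->
    forall n,
      (\int[mu]_(x in E) `|enorm (beta x (un n x)) `^ (p / (p - 1))|%:E <= e%:E)%E.
Hypotheses (mD : forall k, measurable (D k)) (Dfin : forall k, (mu (D k) < +oo)%E).
Hypotheses (ndD : nondecreasing_seq D) (D_cover : forall x, exists k, D k x).

Let p0 : 0 < p. Proof. exact: lt_trans p1. Qed.
Let q0 : 0 < q. Proof. exact: lt_trans q1. Qed.
Local Notation p' := (p / (p - 1)).

Let pm1 : 0 < p - 1. Proof. by rewrite subr_gt0. Qed.
Let p'1 : 1 < p'. Proof. by rewrite ltr_pdivlMr// mul1r gtrBl. Qed.
Let pp' : p^-1 + p'^-1 = 1.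
Proof. by field; rewrite !gt_eqF. Qed.

Let nneg_meas_norm (k : X -> R) : measurable_fun setT k -> nneg_meas (fun x => `|k x|).
Proof. by move=> mk; split=> [|x]; [exact: measurableT_comp|exact: normr_ge0]. Qed.

Let norm_fin (k : X -> R) : mu.-integrable setT (EFin \o k) ->
  measurable_fun setT k /\ (\int[mu]_x `|k x|%:E < +oo)%E.
Proof. by move=> /integrableP[mk kfin]; split=> //; exact/measurable_EFinP. Qed.

Let growth (u : X -> R) (v : X -> borel V) x : R :=
  C1 * (`|u x| `^ q + enorm (v x) `^ p) + `|omega x|.

Let nneg_meas_growth (u : X -> R) (v : X -> borel V) :
  measurable_fun setT u -> measurable_fun setT v ->
  nneg_meas (growth u v).
Proof.
move=> mu_ mv; apply: nneg_measD; last exact: nneg_meas_norm (norm_fin iomega).1.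
apply: nneg_measZ; first exact: ltW.
apply: nneg_measD; last exact: nneg_meas_enorm.
by apply: nneg_meas_powR; exact: (nneg_meas_norm mu_).1.
Qed.

Let growth_int (u : X -> R) (v : X -> borel V) (Ku Kv : R) :
    measurable_fun setT u -> measurable_fun setT v ->
    (\int[mu]_x (`|u x| `^ q)%:E <= Ku%:E)%E ->
    (\int[mu]_x (enorm (v x) `^ p)%:E <= Kv%:E)%E ->
  (\int[mu]_x (growth u v x)%:E <=
   (C1 * (Ku + Kv))%:E + \int[mu]_x `|omega x|%:E)%E.
Proof.
move=> mu_ mv hu hv.
have pu : nneg_meas (fun x => `|u x| `^ q).
  by apply: nneg_meas_powR; exact: (nneg_meas_norm mu_).1.
have pv := nneg_meas_enorm p mv.
have pw := nneg_meas_norm (norm_fin iomega).1.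
have puv := nneg_measD pu pv.
rewrite (nneg_meas_intD mu measurableT (nneg_measZ (ltW C10) puv) pw).
rewrite (nneg_meas_intZ mu measurableT (ltW C10) puv).
rewrite (nneg_meas_intD mu measurableT pu pv) leeD2r// EFinM EFinD.
by apply: lee_wpmul2l; [rewrite lee_fin ltW|exact: leeD].
Qed.

Let growth_le (u : X -> R) (v : X -> borel V) :
  {ae mu, forall x, - growth u v x <= f x (u x) (v x)}.
Proof.
apply: filterS f_growth => x h; apply: le_trans (h (u x) (v x)).
by rewrite /growth; have := ler_norm (omega x); lra.
Qed.

Let Lfun_le (u : X -> R) : u \in Lfun mu q%:E ->
  exists Ku : R, (\int[mu]_x (`|u x| `^ q)%:E <= Ku%:E)%E.
Proof.
move=> /(Lfun_int q0)[mu_ ufin].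
exists (fine (\int[mu]_x (`|u x| `^ q)%:E)); rewrite fineK// ge0_fin_numE//.
by apply: integral_ge0 => x _; rewrite lee_fin powR_ge0.
Qed.

Let growth_integrable (u : X -> R) (v : X -> borel V) (Ku Kv : R) :
    measurable_fun setT u -> measurable_fun setT v ->
    (\int[mu]_x (`|u x| `^ q)%:E <= Ku%:E)%E ->
    (\int[mu]_x (enorm (v x) `^ p)%:E <= Kv%:E)%E ->
  (\int[mu]_x (growth u v x)%:E < +oo)%E.
Proof.
move=> mu_ mv hu hv; apply: le_lt_trans (growth_int mu_ mv hu hv) _.
by rewrite lte_add_pinfty ?ltry//; exact: (norm_fin iomega).2.
Qed.

Let ge_oppr_growth (A : set X) (u : X -> R) (v : X -> borel V) (K : R) : measurable A ->
    measurable_fun setT u -> measurable_fun setT v ->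
    (\int[mu]_x (growth u v x)%:E <= K%:E)%E ->
  ((- K)%:E <= \int[mu]_(x in A) (f x (u x) (v x))%:E)%E.
Proof.
move=> mA mu_ mv gK; have pg := nneg_meas_growth mu_ mv.
have ig : mu.-integrable setT (EFin \o growth u v).
  by apply: nneg_meas_integrable => //; apply: le_lt_trans gK _; rewrite ltry.
have igA : mu.-integrable A (EFin \o growth u v).
  exact: integrableS measurableT mA (@subsetT _ _) ig.
apply: (@le_trans _ _ (\int[mu]_(x in A) (- growth u v x)%:E)%E).
  have -> : (\int[mu]_(x in A) (- growth u v x)%:E =
      - \int[mu]_(x in A) (growth u v x)%:E)%E.
    by rewrite -integral_ge0N// => x _; rewrite lee_fin pg.2.
  rewrite EFinN leeN2; apply: le_trans gK; exact: nneg_meas_intS.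
apply: integrable_ae_le_integral => //.
- exact: (integrableN igA).
- by apply: measurable_funTS; exact: mf.
- by apply: filterS (growth_le u v).
Qed.

Lemma functional_gtNy (u : X -> R) (v : X -> borel V) :
    u \in Lfun mu q%:E -> Lpv mu p v ->
  (-oo < \int[mu]_x (f x (u x) (v x))%:E)%E.
Proof.
move=> Lu [mv vfin]; have [mu_ ufin] := Lfun_int q0 Lu.
have [Ku hu] := Lfun_le Lu.
have vK : (\int[mu]_x (enorm (v x) `^ p)%:E <=
    (fine (\int[mu]_x (enorm (v x) `^ p)%:E))%:E)%E.
  rewrite fineK// ge0_fin_numE//.
  by apply: integral_ge0 => x _; rewrite lee_fin powR_ge0.
have gfin := growth_integrable mu_ mv hu vK.
have g0 : (0 <= \int[mu]_x (growth u v x)%:E)%E.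
  by apply: integral_ge0 => x _; rewrite lee_fin (nneg_meas_growth mu_ mv).2.
apply: (@lt_le_trans _ _ (- fine (\int[mu]_x (growth u v x)%:E))%:E%E).
  by rewrite ltNyr.
by apply: ge_oppr_growth => //; rewrite fineK// ge0_fin_numE.
Qed.

(** This is where equi-integrability enters: with the strong convergence of [un]
   and the boundedness of [vn], it makes the affine lower bound on
   [f x (un n x) (vn n x)] uniformly integrable. *)
Let lower_bound_unif (un : nat -> X -> R) (u : X -> R)
    (vn : nat -> X -> borel V) (K : R) :
    u \in Lfun mu q%:E -> (forall n, measurable_fun setT (un n)) ->
    (forall n, measurable_fun setT (vn n)) ->
    (forall e : R, 0 < e -> \forall n \near \oo,
      (\int[mu]_x (`|un n x - u x| `^ q)%:E <= e%:E)%E) ->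
    (forall n, \int[mu]_x (enorm (vn n x) `^ p)%:E <= K%:E)%E ->
    (forall e : R, 0 < e -> exists2 delta : R, 0 < delta &
      forall E : set X, measurable E -> E `<=` B -> (mu E <= delta%:E)%E ->
      forall n, (\int[mu]_(x in E) `|enorm (beta x (un n x)) `^ p'|%:E <= e%:E)%E) ->
  unif_integrable mu (fun n x => `|alpha x| +
    (C2 * `|un n x| `^ q + enorm (beta x (un n x)) * enorm (vn n x))).
Proof.
move=> Lu mun mvn un_u vn_K equi; have [mu_ ufin] := Lfun_int q0 Lu.
have pal := nneg_meas_norm (norm_fin ialpha).1.
have pnq (k : X -> R) : measurable_fun setT k -> nneg_meas (fun x => `|k x| `^ q).
  by move=> mk; apply: nneg_meas_powR; exact: (nneg_meas_norm mk).1.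
have mbe (k : X -> R) : measurable_fun setT k ->
    measurable_fun setT (fun x => enorm (beta x (k x))).
  by move=> mk; exact: (measurable_enorm (mbeta mk)).
have pbe n : nneg_meas (fun x => enorm (beta x (un n x))).
  by split=> [|x]; [exact: mbe|exact: enorm_ge0].
have pbep (k : X -> R) : measurable_fun setT k ->
    nneg_meas (fun x => enorm (beta x (k x)) `^ p').
  by move=> mk; apply: nneg_meas_powR; exact: mbe.
have pvn n : nneg_meas (fun x => enorm (vn n x)).
  by split=> [|x]; [exact: (measurable_enorm (mvn n))|exact: enorm_ge0].
have puq n : nneg_meas (fun x => C2 * `|un n x| `^ q).
  exact: (nneg_measZ (ltW C20) (pnq _ (mun n))).
have pbv n : nneg_meas (fun x => enorm (beta x (un n x)) * enorm (vn n x)).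
  exact: nneg_measM (pbe n) (pvn n).
apply: unif_integrableD => //.
- by move=> n; exact: nneg_measD (puq n) (pbv n).
- exact: unif_integrable_cst pal (norm_fin ialpha).2.
apply: unif_integrableD => //.
- pose c := C2 * 2 `^ q; have c0 : 0 <= c by rewrite mulr_ge0 ?(ltW C20)// powR_ge0.
  have md n : measurable_fun setT (fun x => un n x - u x) by exact: measurable_funB.
  have ps n : nneg_meas (fun x => `|un n x - u x| `^ q + `|u x| `^ q).
    exact: nneg_measD (pnq _ (md n)) (pnq _ mu_).
  apply: (@unif_integrable_le _ _ _ mu _
      (fun n x => c * (`|un n x - u x| `^ q + `|u x| `^ q))) => // [n|n x|].
  + exact: nneg_measZ.
  + rewrite /c -mulrA ler_wpM2l ?(ltW C20)//.
    apply: le_trans (powRD_le _ _ _); rewrite ?(ltW q0)//.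
    apply: ge0_ler_powR; rewrite ?nnegrE ?addr_ge0 ?(ltW q0)//.
    by rewrite -[in leLHS](subrK (u x) (un n x)); exact: ler_normD.
  + apply: unif_integrableZ => //; apply: unif_integrableD => //.
    * by move=> n; exact: pnq _ (md n).
    * by move=> n; exact: pnq _ mu_.
    * by apply: unif_integrable_cvg0 => // n; exact: pnq _ (md n).
    * exact: unif_integrable_cst (pnq _ mu_) ufin.
- apply: (@unif_integrableM _ _ _ mu p p' K) => //.
  have mnB : measurable (~` B) by exact: measurableC.
  have p0' : measurable_fun setT (fun _ : X => 0 : R) by exact: measurable_cst.
  have p1B n : nneg_meas (fun x => \1_B x * enorm (beta x (un n x)) `^ p').
    exact: nneg_measM (nneg_meas_indic mB) (pbep _ (mun n)).
  have p1nB : nneg_meas (fun x => \1_(~` B) x * enorm (beta x 0) `^ p').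
    exact: nneg_measM (nneg_meas_indic mnB) (pbep _ p0').
  apply: (@unif_integrable_le _ _ _ mu _
      (fun n x => \1_B x * enorm (beta x (un n x)) `^ p' +
      \1_(~` B) x * enorm (beta x 0) `^ p')) => // [n|n|n x|].
  + exact: pbep.
  + exact: nneg_measD (p1B n) p1nB.
  + rewrite !indicE in_setC; case: (boolP (x \in B)) => /= [_|/negP nB].
      by rewrite mul1r mul0r addr0.
    by rewrite mul0r add0r mul1r beta_out// => /mem_set.
  + apply: unif_integrableD => //; last first.
      apply: unif_integrable_cst => //.
      by rewrite nneg_meas_int_indic.
    move=> e e0; have [del del0 hdel] := equi e e0.
    exists B, del; split => //; apply: nearW => n E mE EB.
    rewrite (_ : (\int[mu]_(x in E) _)%E =
        (\int[mu]_(x in E `&` B) `|enorm (beta x (un n x)) `^ p'|%:E)%E).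
      by apply: hdel => //; exact: measurableI.
    rewrite integral_mkcondr; apply: eq_integral => x _.
    rewrite /patch indicE; case: (x \in B); last by rewrite mul0r.
    by rewrite mul1r ger0_norm ?powR_ge0.
Qed.

Lemma functional_lsc (un : nat -> X -> R) (u : X -> R) (vn : nat -> X -> borel V)
    (v : X -> borel V) : Lq_cvg mu q un u -> Lpv_weak_cvg mu p vn v ->
  (\int[mu]_x (f x (u x) (v x))%:E <=
   limn_einf (fun n => \int[mu]_x (f x (un n x) (vn n x))%:E))%E.
Proof.
move=> un_u vn_v; rewrite leNgt; apply/negP => /ereal_between[c [lt_c c_lt]].
(* Along the subsequence [phi] the values stay below [c], and the convergence of
   [un] is fast enough to hold almost everywhere. *)
pose gap (m : nat) : R := 1 / (2 ^ m.+1)%:R.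
have gap0 m : 0 < gap m by rewrite divr_gt0// ltr0n expn_gt0.
have /choice[phi hphi] m : exists n, [/\ (m <= n)%N,
    (\int[mu]_x (f x (un n x) (vn n x))%:E <= c%:E)%E &
    (\int[mu]_x (`|un n x - u x| `^ q)%:E <= (gap m)%:E)%E].
  have [N _ hN] := Lq_cvg_int q0 un_u (gap0 m).
  have [n] := limn_einf_frequently (maxn m N) lt_c.
  by rewrite geq_max => /andP[mn Nn] Fn; exists n; split => //; exact: hN.
have phi_le m : (m <= phi m)%N by have [] := hphi m.
have {un_u} un_u := Lq_cvg_subsequence phi_le un_u.
have {vn_v} vn_v := Lpv_weak_cvg_subsequence phi_le vn_v.
pose un' m := un (phi m); pose vn' m := vn (phi m).
have [Lun Lu _] := un_u; have [Lvn Lv vn_cvg] := vn_v.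
have mun m : measurable_fun setT (un' m) by have [] := Lfun_int q0 (Lun m).
have mvn m : measurable_fun setT (vn' m) by have [] := Lvn m.
have [mu_ ufin] := Lfun_int q0 Lu; have mv := Lv.1.
have [K [vn_K v_K]] := Lpv_weak_cvg_bounded p1 vn_v.
have [Ku hu] := Lfun_le Lu.
have pd m : nneg_meas (fun x => `|un' m x - u x| `^ q).
  apply: nneg_meas_powR; apply: (nneg_meas_norm (k := fun x => un' m x - u x) _).1.
  exact: measurable_funB.
have pu : nneg_meas (fun x => `|u x| `^ q).
  by apply: nneg_meas_powR; exact: (nneg_meas_norm mu_).1.
have un_ae : {ae mu, forall x, un' n x @[n --> \oo] --> u x}.
  have := summable_integrals_ae_cvg0 pd (fun m => let: And3 _ _ h := hphi m in h).
  apply: filterS => x /(powR_cvg0 q0) h.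
  by apply/(@cvg_sub0 _ _ _ _ _ _ (fun=> u x)); [exact: h|exact: cvg_cst].
have un_K m : (\int[mu]_x (`|un' m x| `^ q)%:E <= (2 `^ q * (1 + Ku))%:E)%E.
  apply: (@le_trans _ _ (\int[mu]_x (2 `^ q *
      (`|un' m x - u x| `^ q + `|u x| `^ q))%:E)%E).
    apply: nneg_meas_le => //.
    - by apply: nneg_meas_powR; exact: (nneg_meas_norm (mun m)).1.
    - exact: (nneg_measZ (powR_ge0 _ _) (nneg_measD (pd m) pu)).
    move=> x _; apply: le_trans (powRD_le _ _ _); rewrite ?(ltW q0)//.
    apply: ge0_ler_powR; rewrite ?nnegrE ?addr_ge0 ?(ltW q0)//.
    by rewrite -[in leLHS](subrK (u x) (un' m x)); exact: ler_normD.
  rewrite (nneg_meas_intZ mu measurableT (powR_ge0 _ _) (nneg_measD (pd m) pu)).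
  rewrite EFinM; apply: lee_wpmul2l; first by rewrite lee_fin powR_ge0.
  rewrite (nneg_meas_intD mu measurableT (pd m) pu) EFinD; apply: leeD => //.
  have [_ _ h] := hphi m; apply: le_trans h _.
  rewrite lee_fin /gap ler_pdivrMr ?ltr0n ?expn_gt0//.
  by rewrite mul1r ler1n expn_gt0.
pose KH := C1 * (2 `^ q * (1 + Ku) + K) + fine (\int[mu]_x `|omega x|%:E)%E.
have growth_K m : (\int[mu]_x (growth (un' m) (vn' m) x)%:E <= KH%:E)%E.
  apply: le_trans (growth_int (mun m) (mvn m) (un_K m) (vn_K m)) _.
  rewrite /KH EFinD fineK// ge0_fin_numE ?(norm_fin iomega).2//.
  by apply: integral_ge0 => x _; rewrite lee_fin.
have mnB : measurable (~` B) by exact: measurableC.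
have sup_fin : (ereal_sup (range (fun m =>
    \int[mu]_(x in B) (f x (un' m x) (vn' m x))%:E)) < +oo)%E.
  apply: (@le_lt_trans _ _ (c + KH)%:E); last by rewrite ltry.
  apply: ge_ereal_sup => _ [m _ <-].
  have [_ Fm _] := hphi m.
  have h := ge_oppr_growth mnB (mun m) (mvn m) (growth_K m).
  move: Fm; rewrite -(setUv B) integral_setU//; last 2 first.
  - by rewrite setUv; apply/measurable_EFinP; exact: mf (mun m) (mvn m).
  - by rewrite disj_set2E setICr.
  move=> Fm; rewrite EFinD -leeBlDr//; apply: le_trans Fm.
  by rewrite -EFinN leeD2l.
have equi := beta_equi un_u vn_v sup_fin.
have un_cvg e : 0 < e -> \forall n \near \oo,
    (\int[mu]_x (`|un' n x - u x| `^ q)%:E <= e%:E)%E.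
  exact: (Lq_cvg_int q0 un_u).
have unifG := lower_bound_unif Lu mun mvn un_cvg vn_K equi.
move: c_lt; rewrite ltNge => /negP; apply.
apply: (@integral_lsc_le _ _ _ _ mu p p' K c f un' u vn' v
  (fun n x => `|alpha x| +
    (C2 * `|un' n x| `^ q + enorm (beta x (un' n x)) * enorm (vn' n x)))
  (growth u v) p1 p'1 pp' _ _ _ f_lsc f_conv un_ae mvn mv vn_K v_K _ _
  unifG _ _ _ _ _ D mD Dfin ndD D_cover).
- by move=> n; exact: mf (mun n) (mvn n).
- exact: mf.
- by move=> xi; apply: (mf mu_ (v := fun=> xi)); exact: measurable_cst.
- by move=> b mb bfin; apply: vn_cvg;
    exact: (pairing_dual p0 (lt_trans ltr01 p'1) pp' mb bfin).
- move=> n; apply: nneg_measD; first exact: nneg_meas_norm (norm_fin ialpha).1.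
  apply: nneg_measD.
    apply: nneg_measZ; first exact: ltW.
    by apply: nneg_meas_powR; exact: (nneg_meas_norm (mun n)).1.
  apply: nneg_measM; split=> [|x]; rewrite ?enorm_ge0//.
    exact: (measurable_enorm (mbeta (mun n))).
  exact: (measurable_enorm (mvn n)).
- apply: filterS f_affine => x h n; apply: le_trans (h (un' n x) (vn' n x)).
  have := dotp_ge (beta x (un' n x)) (vn' n x).
  have := ler_norm (- alpha x); rewrite normrN; lra.
- exact: nneg_meas_growth.
- exact: growth_integrable hu v_K.
- exact: growth_le.
- by move=> n; have [] := hphi n.
Qed.

End main_inequality.

(** * The case of Lebesgue measure *)

Section lebesgue_specialisation.
Context {R : realType} {d : nat}.
Local Notation V := 'rV[R]_d.+1.
Local Notation X := (lebRn R d).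
Local Notation mu := (lebesgue_Rn R d).

Lemma Lp_vecP (p : R) (v : X -> borel V) : 0 < p -> Lp_vec setT p v <-> Lpv mu p v.
Proof.
move=> p0; split=> -[mv vfin]; split; [exact: mv| |exact: mv|exact: poweR_lty].
rewrite ltey; apply/negP => /eqP h; move: vfin; rewrite /Lpnorm_vec h /=.
by rewrite gt_eqF ?invr_gt0.
Qed.

Lemma Lp_vec_dualP (p : R) L : 0 < p ->
  Lp_vec_dual p L <-> bounded_linear mu p L.
Proof.
move=> p0; split=> -[Llin [K LK]]; split.
- move=> a v w Lv Lw.
  exact: Llin ((Lp_vecP v p0).2 Lv) ((Lp_vecP w p0).2 Lw).
- exists K => v Lv; have := LK v ((Lp_vecP v p0).2 Lv).
  by rewrite /Lpnorm_vec; have -> := Lpv_normE Lv; rewrite -EFinM lee_fin.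
- move=> a v w Lv Lw.
  exact: Llin ((Lp_vecP v p0).1 Lv) ((Lp_vecP w p0).1 Lw).
- exists K => v /((Lp_vecP v p0).1) Lv; rewrite /Lpnorm_vec.
  by have -> := Lpv_normE Lv; rewrite -EFinM lee_fin; exact: LK.
Qed.

Lemma Lp_weak_cvgP (p : R) vn v : 0 < p ->
  Lp_weak_cvg p vn v <-> Lpv_weak_cvg mu p vn v.
Proof.
move=> p0; split=> -[Lvn Lv cvg]; split=> [n||L Ldual].
- exact: (Lp_vecP _ p0).1 (Lvn n).
- exact: (Lp_vecP _ p0).1 Lv.
- exact: cvg L ((Lp_vec_dualP L p0).2 Ldual).
- exact: (Lp_vecP _ p0).2 (Lvn n).
- exact: (Lp_vecP _ p0).2 Lv.
- exact: cvg L ((Lp_vec_dualP L p0).1 Ldual).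
Qed.

Lemma convex_functionP (g : V -> R) :
  convex_function [set: convex_lmodType V] (g : convex_lmodType V -> R^o) ->
  forall (t : R) (y z : V), 0 <= t <= 1 ->
    g (t *: y + (1 - t) *: z) <= t * g y + (1 - t) * g z.
Proof.
move=> g_conv t y z /andP[t0 t1].
have := g_conv (Itv01 t0 t1) y z; rewrite !inE => /(_ I I).
by [].
Qed.

End lebesgue_specialisation.

Theorem theorem1p10 (R : realType) (d : nat) (p q : R)
    (f : 'rV[R]_d.+1 -> R -> 'rV[R]_d.+1 -> R)
    (C1 : R) (omega : lebRn R d -> R)
    (C2 : R) (alpha : lebRn R d -> R)
    (beta : 'rV[R]_d.+1 -> R -> 'rV[R]_d.+1)
    (betat : lebRn R d -> borel 'rV[R]_d.+1) (r : R)
    (hp : 1 < p) (hq : 1 < q)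
    (mf : measurable_fun
      [set: (lebRn R d * borel (R * 'rV[R]_d.+1))%type]
      (fun w => f w.1 w.2.1 w.2.2))
    (hC1 : 0 < C1) (homega : omega \in Lfun (lebesgue_Rn R d) 1%E)
    (f_growth : {ae lebesgue_Rn R d, forall x, forall z xi,
      f x z xi >= - C1 * (`|z| `^ q + enorm xi `^ p) - omega x})
    (f_lsc : {ae lebesgue_Rn R d, forall x, lower_semicontinuous
      (fun w : (R * 'rV[R]_d.+1)%type => (f x w.1 w.2)%:E)})
    (f_convex : {ae lebesgue_Rn R d, forall x, forall z,
      convex_function [set: convex_lmodType 'rV[R]_d.+1] (f x z)})
    (hC2 : 0 < C2) (halpha : alpha \in Lfun (lebesgue_Rn R d) 1%E)
    (mbeta : measurable_fun [set: (lebRn R d * R)%type]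
      (fun w => beta w.1 w.2 : borel 'rV[R]_d.+1))
    (hr : 0 < r)
    (beta_out : forall x z, (~` eball r) x -> beta x z = betat x)
    (hbetat : Lp_vec (~` eball r) (p / (p - 1)) betat)
    (f_affine : {ae lebesgue_Rn R d, forall x, forall z xi,
      f x z xi >= alpha x - C2 * `|z| `^ q + dotp (beta x z) xi})
    (beta_equi : forall un u vn v,
      Lq_strong_cvg q un u -> Lp_weak_cvg p vn v ->
      (ereal_sup (range (fun n => \int[lebesgue_Rn R d]_(x in eball r)
         (f x (un n x) (vn n x))%:E)) < +oo)%E ->
      equi_integrable (eball r)
        (fun n x => enorm (beta x (un n x)) `^ (p / (p - 1)))) :
  let F (u : lebRn R d -> R) (v : lebRn R d -> borel 'rV[R]_d.+1) :=
    (\int[lebesgue_Rn R d]_x (f x (u x) (v x))%:E)%E in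
  (forall u v, u \in Lfun (lebesgue_Rn R d) q%:E -> Lp_vec setT p v ->
     (-oo < F u v)%E) /\
  strong_weak_seq_lsc q p F.
Proof.
have p0 : 0 < p by exact: lt_trans hp.
have p'0 : 0 < p / (p - 1) by rewrite divr_gt0// subr_gt0.
have mcomp (u : lebRn R d -> R) (v : lebRn R d -> borel 'rV[R]_d.+1) :
    measurable_fun setT u -> measurable_fun setT v ->
    measurable_fun setT (fun x : lebRn R d => f x (u x) (v x)).
  move=> mu mv; have muv := measurable_fun_pair_borel measurableT mu mv.
  exact: (measurableT_comp mf (measurable_fun_pair (@measurable_id _ _ setT) muv)).
have mbcomp (u : lebRn R d -> R) : measurable_fun setT u ->
    measurable_fun setT ((fun x : lebRn R d => beta x (u x)) :
      lebRn R d -> borel 'rV[R]_d.+1).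
  move=> mu.
  exact: (measurableT_comp mbeta (measurable_fun_pair (@measurable_id _ _ setT) mu)).
have iomega := (Lfun1_integrable _ _).1 homega.
have ialpha := (Lfun1_integrable _ _).1 halpha.
have f_conv : {ae lebesgue_Rn R d, forall x, forall z t y1 y2, 0 <= t <= 1 ->
    f x z (t *: y1 + (1 - t) *: y2) <= t * f x z y1 + (1 - t) * f x z y2}.
  apply: (@filterS _ _ (ae_filter_ringOfSetsType (lebesgue_Rn R d)) _ _ _ f_convex).
  by move=> x h z; exact: convex_functionP.
have mB := @measurable_eball R d r.
have Bfin := @lebesgue_eball_lty R d r.
have b_out x z : ~ eball r x -> beta x z = beta x 0.
  by move=> nB; rewrite (beta_out x z nB) (beta_out x 0 nB).
have b_fin : (\int[lebesgue_Rn R d]_(x in ~` eball r)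
    (enorm (beta x 0) `^ (p / (p - 1)))%:E < +oo)%E.
  have -> : (\int[lebesgue_Rn R d]_(x in ~` eball r)
      (enorm (beta x 0) `^ (p / (p - 1)))%:E =
    \int[lebesgue_Rn R d]_(x in ~` eball r)
      (enorm (betat x) `^ (p / (p - 1)))%:E)%E.
    by apply: eq_integral => x /set_mem nB; rewrite (beta_out x 0 nB).
  rewrite ltey; apply/negP => /eqP h; move: hbetat.2; rewrite /Lpnorm_vec h /=.
  by rewrite gt_eqF ?invr_gt0.
have b_equi un u vn v : Lq_cvg (lebesgue_Rn R d) q un u ->
    Lpv_weak_cvg (lebesgue_Rn R d) p vn v -> _ -> _ :=
  fun un_u vn_v => beta_equi un u vn v un_u ((Lp_weak_cvgP vn v p0).2 vn_v).
have mD k := @measurable_eball R d k%:R.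
have Dfin k := @lebesgue_eball_lty R d k%:R.
have ndD : nondecreasing_seq (fun k => eball k%:R : set (lebRn R d)).
  by move=> m n mn; apply/subsetPset => x /= /lt_le_trans; apply; rewrite ler_nat.
have D_cover (x : lebRn R d) : exists k, (eball k%:R : set (lebRn R d)) x.
  by exists (Num.truncn (enorm x)).+1; exact: truncnS_gt.
split.
  move=> u v Lu Lv.
  exact: (functional_gtNy hq hC1 mcomp iomega f_growth Lu ((Lp_vecP v p0).1 Lv)).
move=> un u vn v un_u vn_v.
exact: (functional_lsc hp hq hC1 hC2 mcomp mbcomp iomega ialpha f_growth f_lsc f_conv
  f_affine mB Bfin b_out b_fin b_equi mD Dfin ndD D_cover un_u
  ((Lp_weak_cvgP vn v p0).1 vn_v)).
Qed.
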